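(* Let $n\ge 2$, $d\ge 1$, let $k\ge 0$ be an integer, and let $\Omega\subset\mathbb{R}^d$ be compact. Let $f:\Omega^n\to\mathbb{R}$ be totally symmetric and $\mathcal{C}^k$. Then for every $\epsilon>0$ there exists a totally symmetric polynomial $P$ (a real polynomial in the $dn$ coordinates of $(\mathbb{R}^d)^n$) such that $$\|f-P\|_{\mathcal{C}^k(\Omega^n)}<\epsilon .$$
   Context: Points of $(\mathbb{R}^d)^n$ are written $\boldsymbol{x}=(\boldsymbol{x}_1,\dots,\boldsymbol{x}_n)$ with $\boldsymbol{x}_i\in\mathbb{R}^d$. For $\sigma$ in the symmetric group $\mathcal{S}_n$, $\sigma.\boldsymbol{x}:=(\boldsymbol{x}_{\sigma(1)},\dots,\boldsymbol{x}_{\sigma(n)})$. A function $f$ is totally symmetric if $f(\sigma.\boldsymbol{x})=f(\boldsymbol{x})$ for all $\sigma\in\mathcal{S}_n$ and all $\boldsymbol{x}$ in its domain. For compact $V\subset(\mathbb{R}^d)^n$, pick any open set $U$ with $V\subset U\subseteq(\mathbb{R}^d)^n$ and put $\mathcal{C}^k(V)=\{F|_V: F\in\mathcal{C}^k(U)\}$, where $\mathcal{C}^k(U)$ is the set of $k$ times continuously differentiable real functions on $U$; this space is regarded as independent of the choice of $U$. The norm is given by the maxima of the continuous derivatives up to order $k$, restricted to $V$: $$\|p\|_{\mathcal{C}^k(V)}:=\sum_{|\alpha|\le k}\max_{\boldsymbol{x}\in V}|(D^\alpha p)(\boldsymbol{x})|,$$ with $\alpha\in\mathbb{Z}_{\ge0}^{dn}$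 a multi-index.
   Formalization: The C^k norm on Ω^n is taken as the infimum, over all C^k extensions to an open neighbourhood, of the displayed sum of maxima, since derivatives on Ω^n need not be determined by the function there (e.g. Ω a point); where they are determined it equals the displayed norm. *)

(* Defs.v *)
From HB Require Import structures.
From mathcomp Require Import all_boot all_order all_algebra all_fingroup.
From mathcomp Require Import all_classical all_reals all_analysis.
From mathcomp Require mpoly.

Set Implicit Arguments.
Unset Strict Implicit.
Unset Printing Implicit Defensive.

Import Order.TTheory GRing.Theory Num.Theory.
Import numFieldNormedType.Exports.

Local Open Scope classical_set_scope.
Local Open Scope ring_scope.

(* A point x = (x_1, ..., x_n) of (R^d)^n is the n x d matrix with rows x_i;
   [row_perm s x] is then s.x = (x_{s(1)}, ..., x_{s(n)}).  A function on a
   subset V of (R^d)^n is a total function of which only the values on V are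
   ever used. *)

Definition cart_pow (R : realType) (n d : nat) (Omega : set 'rV[R]_d) :
    set 'M[R]_(n, d) :=
  [set x | forall i, Omega (row i x)].

Arguments cart_pow {R} n {d} Omega.

Definition totally_symmetric_on (R : realType) (n d : nat)
    (V : set 'M[R]_(n, d)) (f : 'M[R]_(n, d) -> R) : Prop :=
  forall (s : 'S_n) (x : 'M[R]_(n, d)), V x -> f (row_perm s x) = f x.

Definition partial (R : realType) (n d : nat) (i : 'I_n) (j : 'I_d)
    (F : 'M[R]_(n, d) -> R) : 'M[R]_(n, d) -> R :=
  fun x => 'D_(delta_mx i j) F x.

(* For open U: all iterated partial derivatives up to order k exist and are
   continuous at every point of U. *)
Fixpoint Ck_open (R : realType) (n d k : nat) (U : set 'M[R]_(n, d))
    (F : 'M[R]_(n, d) -> R) : Prop :=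
  (forall x, U x -> {for x, continuous F}) /\
  (if k is k'.+1 then
     forall (i : 'I_n) (j : 'I_d),
       (forall x, U x -> derivable F x (delta_mx i j)) /\
       Ck_open k' U (partial i j F)
   else True).

Definition mindex_deg (n d k : nat) (a : 'M['I_k.+1]_(n, d)) : nat :=
  (\sum_i \sum_j (a i j : nat))%N.

(* The order of differentiation is that of [enum]; it is immaterial for C^k
   functions. *)
Definition Dmulti (R : realType) (n d k : nat) (a : 'M['I_k.+1]_(n, d))
    (F : 'M[R]_(n, d) -> R) : 'M[R]_(n, d) -> R :=
  foldr (fun ij : 'I_n * 'I_d => iter (a ij.1 ij.2) (partial ij.1 ij.2))
    F (enum {: 'I_n * 'I_d}).

Definition Ck_extension (R : realType) (n d k : nat) (V : set 'M[R]_(n, d))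
    (g G : 'M[R]_(n, d) -> R) : Prop :=
  (exists U : set 'M[R]_(n, d), [/\ open U, V `<=` U & Ck_open k U G]) /\
  (forall x, V x -> G x = g x).

Definition Ck_on (R : realType) (n d k : nat) (V : set 'M[R]_(n, d))
    (g : 'M[R]_(n, d) -> R) : Prop :=
  exists G, Ck_extension k V g G.

(* The suprema are maxima when V is compact and nonempty and G is C^k near V;
   they are 0 when V is empty. *)
Definition Ck_sum (R : realType) (n d k : nat) (V : set 'M[R]_(n, d))
    (G : 'M[R]_(n, d) -> R) : R :=
  \sum_(a : 'M['I_k.+1]_(n, d) | (mindex_deg a <= k)%N)
    sup [set `|Dmulti a G x| | x in V].

(* On a general compact V (say, a point) the values of g on V do not determine
   the derivatives on V of a C^k extension G of g, so the norm is the quotient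
   norm of C^k(V) as a space of restrictions: the infimum over all extensions.
   When V is contained in the closure of its interior, the derivatives on V are
   determined by g and no infimum is needed: see [Ck_norm_regular].  Functions
   that are not C^k on V get norm +oo. *)
Definition Ck_norm (R : realType) (n d k : nat) (V : set 'M[R]_(n, d))
    (g : 'M[R]_(n, d) -> R) : \bar R :=
  ereal_inf [set (Ck_sum k V G)%:E | G in Ck_extension k V g].

(* The nd coordinates of (R^d)^n are numbered row by row, as in [mxvec]. *)
Definition poly_fun (R : realType) (n d : nat) (P : mpoly.mpoly (n * d) R) :
    'M[R]_(n, d) -> R :=
  fun x => mpoly.meval (fun l => mxvec x 0 l) P.

Lemma Ck_open_iter (R : realType) (n d k m : nat) (i : 'I_n) (j : 'I_d)
    (U : set 'M[R]_(n, d)) (F : 'M[R]_(n, d) -> R) :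
  Ck_open (m + k) U F -> Ck_open k U (iter m (partial i j) F).
Proof.
elim: m k => [|m IH] k //= FU.
have /= := IH k.+1; rewrite addnS => /(_ FU) [_ /(_ i j)[]].
by [].
Qed.

Lemma Dmulti_continuous (R : realType) (n d k : nat) (a : 'M['I_k.+1]_(n, d))
    (U : set 'M[R]_(n, d)) (F : 'M[R]_(n, d) -> R) :
  (mindex_deg a <= k)%N -> Ck_open k U F ->
  forall x, U x -> {for x, continuous (Dmulti a F)}.
Proof.
rewrite /mindex_deg pair_bigA /= /Dmulti => ak FU.
have {}ak : (\sum_(p <- enum {: 'I_n * 'I_d}) (a p.1 p.2 : nat) <= k)%N.
  by rewrite big_enum.
suff [m] : exists m, Ck_open m
    U (foldr (fun ij => iter (a ij.1 ij.2) (partial ij.1 ij.2)) F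
    (enum {: 'I_n * 'I_d})) by case: m => [|m] [].
exists (k - \sum_(p <- enum {: 'I_n * 'I_d}) (a p.1 p.2 : nat))%N.
elim: (enum _) ak => [|p s IH] /=; first by rewrite big_nil subn0.
rewrite big_cons => ak.
apply: Ck_open_iter; rewrite addnC subnDA subnAC subnK.
  by apply: IH; apply: leq_trans ak; exact: leq_addl.
by rewrite leq_subRL ?(leq_trans _ ak) ?leq_addl // addnC.
Qed.

Lemma Dmulti_local (R : realType) (n d k : nat) (a : 'M['I_k.+1]_(n, d))
    (W : set 'M[R]_(n, d)) (G H : 'M[R]_(n, d) -> R) :
  open W -> {in W, G =1 H} -> {in W, Dmulti a G =1 Dmulti a H}.
Proof.
move=> oW GH; rewrite /Dmulti; elim: (enum _) => [//|p s IH] /=.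
elim: (nat_of_ord _) => [//|m {}IH] /= x xW.
apply: near_eq_derive.
have := open_nbhs_nbhs (conj oW (set_mem xW)).
by apply: filterS => y Wy; apply: IH; rewrite inE.
Qed.

Lemma Ck_norm_regular (R : realType) (n d k : nat) (V : set 'M[R]_(n, d))
    (g G : 'M[R]_(n, d) -> R) :
  V `<=` closure (interior V) -> Ck_extension k V g G ->
  Ck_norm k V g = (Ck_sum k V G)%:E.
Proof.
move=> Vreg [[U [oU VU GU]] Gg].
have uniqS H : Ck_extension k V g H -> Ck_sum k V H = Ck_sum k V G.
  move=> [[U' [_ VU' HU]] Hg].
  apply: eq_bigr => a ak; congr sup.
  have HG x : V x -> Dmulti a H x = Dmulti a G x.
    move=> Vx; apply/eqP; rewrite -subr_eq0; apply/negPn/negP => neq.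
    have cH := Dmulti_continuous ak HU (VU' _ Vx).
    have cG := Dmulti_continuous ak GU (VU _ Vx).
    have c : (fun y => Dmulti a H y - Dmulti a G y) @ x -->
             Dmulti a H x - Dmulti a G x by exact: (cvgB cH cG).
    have [y [Vy]] := Vreg x Vx _ (cvgr_neq0 _ c neq).
    have oV : open (interior V) by exact: open_interior.
    have E : {in (interior V : set 'M[R]_(n, d)), H =1 G}.
      by move=> z; rewrite inE => /interior_subset Vz; rewrite Hg // Gg.
    by rewrite /= (Dmulti_local a oV E) ?inE // subrr eqxx.
  by apply/seteqP; split => _ [x Vx <-] /=; exists x => //; rewrite HG.
rewrite /Ck_norm (_ : [set _ | _ in _] = [set (Ck_sum k V G)%:E]) ?ereal_inf1 //.
apply/seteqP; split=> [_ [H eH <-]|_ ->] /=; first by rewrite uniqS.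
by exists G => //; split => //; exists U.
Qed.

(* Main.v *)
(* The norm of C^k(V) is an infimum over C^k extensions, so only the values on V
   have to be matched: multiplying an extension of f by a C^k cutoff equal to 1
   on V gives an extension H that is C^k on the whole space.  All partial
   derivatives of H up to order k are then approximated uniformly on a cube
   containing V by those of a polynomial p, applying a Bernstein operator in one
   coordinate after the other; a derivative of a Bernstein operator is a
   Bernstein operator applied to difference quotients, which converge to the
   derivatives of H.  Since V is invariant under permutations and f is symmetric,
   averaging H - p over the symmetric group gives an extension of f - P, where P
   is the average of p, that is no larger in C^k norm over the cube. *)

Require Import Defs.
From mathcomp Require Import all_boot all_order all_algebra all_fingroup.
From mathcomp Require Import all_classical all_reals all_analysis.
From mathcomp Require Import ring lra.
From mathcomp Require mpoly.

Set Implicit Arguments.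
Unset Strict Implicit.
Unset Printing Implicit Defensive.

Import Order.TTheory GRing.Theory Num.Theory.
Import numFieldNormedType.Exports.

Local Open Scope classical_set_scope.
Local Open Scope ring_scope.

(** * C^k functions on open sets *)

(** Nodes and mean-value points leave $V$, and the estimates move along whole segments; hence a
    global extension and a cube. The cube has equal sides so that row permutations preserve it.
    Differentiating a Bernstein operator $r$ times in its own coordinate lowers its degree from $N$
    to $N-r$, keeps the node spacing $2M/N$ and produces the factor $N(N-1)\cdots(N-r+1)/N^r$. So
    degree and spacing are separate parameters, and the $C^k$ estimate is stated for every $r$ at
    once: its induction on $k$ closes because a derivative in the operator's own coordinate replaces
    $r$ by $r+1$, while a derivative in another coordinate passes onto $F$. The latter rests on the
    symmetry of mixed derivatives. One Bernstein operator makes the function polynomial in one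
    coordinate only, with coefficients that are still $C^k$ functions of the others. Hence the
    limits of polynomials are treated as a class stable under sums, scalars and multiplication by a
    coordinate. *)

Lemma is_derive_transport (R : numFieldType) (V V' W : normedModType R)
    (f : V -> W) (g : V' -> W) (x v : V) (y w : V') (df : W) :
  (forall h : R, f (h *: v + x) = g (h *: w + y)) ->
  is_derive x v f df -> is_derive y w g df.
Proof.
move=> fg; have f0 : f x = g y.
  by have := fg 0; rewrite !scale0r !add0r.
(* A directional derivative sees a function only along one line, so base point, direction and even
   the ambient space may change. *)
have E : (fun h : R => h^-1 *: ((f \o shift x) (h *: v) - f x)) =
         (fun h : R => h^-1 *: ((g \o shift y) (h *: w) - g y)).
  by apply/funext => h /=; rewrite fg f0.
move=> [fx <-]; apply: DeriveDef; first by rewrite /derivable -E.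
by rewrite /derive E.
Qed.

Lemma is_derive_line (R : numFieldType) (V W : normedModType R) (f : V -> W)
    (y v : V) (t : R) :
  derivable f (t *: v + y) v ->
  is_derive t 1 (fun s : R => f (s *: v + y)) ('D_v f (t *: v + y)).
Proof.
move=> /derivableP; apply: is_derive_transport => h.
by rewrite scalerDl addrA; congr (f (_ *: _ + _ + _)); rewrite [_ *: _]mulr1.
Qed.

(** Restricting to the line through [x] in direction [v] reduces this to the one-variable chain
    rule, so [S] is assumed derivable in that direction only. *)
Lemma is_derive_comp_line (R : realType) (V : normedModType R) (h : R -> R)
    (S : V -> R) (x v : V) (a b : R) :
  is_derive (S x) 1 h a -> is_derive x v S b -> is_derive x v (h \o S) (a * b).
Proof.
move=> dh dS.
have dl : is_derive (0 : R) 1 (fun s : R => S (s *: v + x)) b.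
  apply: is_derive_transport dS => s.
  by rewrite addr0 [_ *: 1]mulr1.
have dh' : is_derive (S (0 *: v + x)) 1 h a by rewrite scale0r add0r.
have := is_derive1_comp dh' dl.
by apply: is_derive_transport => s /=; rewrite addr0 [_ *: 1]mulr1.
Qed.

Lemma near_eq_continuous_at (T U : topologicalType) (f g : T -> U) (x : T) :
  (\forall y \near x, f y = g y) -> {for x, continuous f} -> {for x, continuous g}.
Proof.
move=> fg; rewrite /prop_for /continuous_at -(nbhs_singleton fg).
by apply: cvg_trans; apply: near_eq_cvg.
Qed.

Lemma near_open (T : topologicalType) (U : set T) (x : T) :
  open U -> U x -> \forall y \near x, U y.
Proof. by move=> oU Ux; apply: open_nbhs_nbhs. Qed.

Section Ck_closure.
Context {R : realType} {n d : nat}.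
Implicit Types (U : set 'M[R]_(n, d)) (F G : 'M[R]_(n, d) -> R) (k : nat).

Lemma Ck_open_continuous k U F x : Ck_open k U F -> U x -> {for x, continuous F}.
Proof. by case: k => [|k] [+ _]; apply. Qed.

Lemma Ck_open_le m k U F : (m <= k)%N -> Ck_open k U F -> Ck_open m U F.
Proof.
elim: k m F => [|k IH] [|m] F //= mk [cF dF]; split=> // i j.
by have [? ?] := dF i j; split=> //; apply: IH.
Qed.

Lemma Ck_open_sub k U U' F : U `<=` U' -> Ck_open k U' F -> Ck_open k U F.
Proof.
elim: k F => [|k IH] F UU' /= [cF dF]; split=> //; first by move=> x /UU'/cF.
  by move=> x /UU'/cF.
by move=> i j; have [H ?] := dF i j; split; [move=> x /UU'/H | exact: IH].
Qed.

(** [Ck_open] is pointwise in [U] and [partial] is taken of the total function, so the two pieces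
    agree on the overlap automatically. *)
Lemma Ck_openU k U U' F : Ck_open k U F -> Ck_open k U' F -> Ck_open k (U `|` U') F.
Proof.
elim: k F => [|k IH] F /= [cF dF] [cF' dF'].
  by split=> // x [/cF|/cF'].
split; first by move=> x [/cF|/cF'].
move=> i j; have [H ?] := dF i j; have [H' ?] := dF' i j.
by split; [move=> x [/H|/H'] | exact: IH].
Qed.

Lemma eq_Ck_open k U F G : open U -> (forall x, U x -> F x = G x) ->
  Ck_open k U F -> Ck_open k U G.
Proof.
move=> oU; have nE H H' : (forall x, U x -> H x = H' x) ->
    forall x, U x -> \forall y \near x, H y = H' y.
  by move=> HH' x Ux; apply: filterS (near_open oU Ux) => y /HH'.
elim: k F G => [|k IH] F G FG /= [cF dF].
  split=> // x Ux; apply: near_eq_continuous_at (cF x Ux); exact: (nE _ _ _ FG _ Ux).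
split=> [x Ux|i j].
  by apply: near_eq_continuous_at (cF x Ux); exact: (nE _ _ _ FG _ Ux).
have [dx dC] := dF i j; split=> [x Ux|].
  by apply: near_eq_derivable (dx x Ux); exact: (nE _ _ _ FG _ Ux).
apply: IH dC => x Ux; apply: near_eq_derive; exact: (nE _ _ _ FG _ Ux).
Qed.

(** Introduction rule with the partial derivatives given by formulas; the closure properties below
    are inductions on [k] through it. *)
Lemma Ck_openS k U F (dF : 'I_n -> 'I_d -> 'M[R]_(n, d) -> R) : open U ->
  (forall x, U x -> {for x, continuous F}) ->
  (forall i j x, U x -> is_derive x (delta_mx i j) F (dF i j x)) ->
  (forall i j, Ck_open k U (dF i j)) -> Ck_open k.+1 U F.
Proof.
move=> oU cF dFE dFk; split=> // i j; split=> [x /(dFE i j)[]//|].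
apply: eq_Ck_open (dFk i j) => // x Ux; rewrite /partial.
by case: (dFE i j x Ux) => _ ->.
Qed.

Lemma Ck_open_derive k U F i j x : Ck_open k.+1 U F -> U x ->
  is_derive x (delta_mx i j) F (partial i j F x).
Proof. by move=> [_ /(_ i j)[+ _]] Ux => /(_ x Ux)/derivableP. Qed.

Lemma Ck_open_partial k U F i j : Ck_open k.+1 U F -> Ck_open k U (partial i j F).
Proof. by move=> [_ /(_ i j)[]]. Qed.

Lemma Ck_openD k U F G : open U ->
  Ck_open k U F -> Ck_open k U G -> Ck_open k U (fun x => F x + G x).
Proof.
move=> oU; elim: k F G => [|k IH] F G CF CG.
  split=> // x Ux; exact: continuousD (Ck_open_continuous CF Ux) (Ck_open_continuous CG Ux).
apply: (@Ck_openS _ _ _ (fun i j x => partial i j F x + partial i j G x)) => //.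
- move=> x Ux; exact: continuousD (Ck_open_continuous CF Ux) (Ck_open_continuous CG Ux).
- by move=> i j x Ux; apply: is_deriveD; [exact: Ck_open_derive CF Ux|exact: Ck_open_derive CG Ux].
- by move=> i j; apply: IH; [exact: Ck_open_partial CF|exact: Ck_open_partial CG].
Qed.

Lemma Ck_openM k U F G : open U ->
  Ck_open k U F -> Ck_open k U G -> Ck_open k U (fun x => F x * G x).
Proof.
move=> oU; elim: k F G => [|k IH] F G CF CG.
  split=> // x Ux; exact: continuousM (Ck_open_continuous CF Ux) (Ck_open_continuous CG Ux).
apply: (@Ck_openS _ _ _ (fun i j x => F x * partial i j G x + G x * partial i j F x)) => //.
- move=> x Ux; exact: continuousM (Ck_open_continuous CF Ux) (Ck_open_continuous CG Ux).
- by move=> i j x Ux; apply: is_deriveM; [exact: Ck_open_derive CF Ux|exact: Ck_open_derive CG Ux].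
- move=> i j; apply: Ck_openD => //; apply: IH.
  + exact: Ck_open_le (leqnSn k) CF.
  + exact: Ck_open_partial CG.
  + exact: Ck_open_le (leqnSn k) CG.
  + exact: Ck_open_partial CF.
Qed.

Lemma Ck_open_cst k U (c : R) : open U -> Ck_open k U (fun=> c).
Proof.
move=> oU; elim: k c => [|k IH] c; first by split=> // x _; exact: cst_continuous.
by apply: (@Ck_openS _ _ _ (fun _ _ => fun=> 0)) => // x _; exact: cst_continuous.
Qed.

Lemma Ck_openZ k U (c : R) F : open U ->
  Ck_open k U F -> Ck_open k U (fun x => c * F x).
Proof. by move=> oU CF; apply: Ck_openM => //; exact: Ck_open_cst. Qed.

Lemma Ck_openB k U F G : open U ->
  Ck_open k U F -> Ck_open k U G -> Ck_open k U (fun x => F x - G x).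
Proof.
move=> oU CF CG; rewrite (_ : (fun _ => _) = fun x => F x + -1 * G x).
  by apply: Ck_openD => //; exact: Ck_openZ.
by apply/funext => x; rewrite mulN1r.
Qed.

Lemma Ck_open_sum k U (I : Type) (r : seq I) (P : pred I)
    (F : I -> 'M[R]_(n, d) -> R) :
  open U -> (forall i, P i -> Ck_open k U (F i)) ->
  Ck_open k U (fun x => \sum_(i <- r | P i) F i x).
Proof.
move=> oU CF; rewrite (_ : (fun _ => _) = \sum_(i <- r | P i) F i).
  elim/big_rec : _ => [|i G Pi CG]; first exact: Ck_open_cst.
  exact: Ck_openD (CF i Pi) CG.
by apply/funext => x; rewrite fct_sumE.
Qed.

Lemma is_derive_coord (a : 'I_n) (b : 'I_d) (i : 'I_n) (j : 'I_d) (x : 'M[R]_(n, d)) :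
  is_derive x (delta_mx i j) (fun y : 'M[R]_(n, d) => y a b)
    ((i == a) && (j == b))%:R.
Proof.
set e := (_ && _)%:R.
have H : is_derive (0 : R) 1 (fun t : R => t * e + x a b) e.
  have := is_deriveD (is_deriveZ e (is_derive_id (0 : R) 1))
    (is_derive_cst (x a b) (0 : R) 1).
  rewrite addr0 [_ *: _]mulr1; apply: is_derive_transport => h.
  by rewrite addr0 [_ *: 1]mulr1 /GRing.add /= [e *: h]mulrC.
apply: is_derive_transport H => h.
by rewrite addr0 [_ *: 1]mulr1 !mxE /e eq_sym [b == j]eq_sym.
Qed.

Lemma Ck_open_coord k U (a : 'I_n) (b : 'I_d) : open U -> Ck_open k U (fun x => x a b).
Proof.
move=> oU; case: k => [|k]; first by split=> // x _; exact: coord_continuous.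
apply: (@Ck_openS _ _ _ (fun i j => fun=> ((i == a) && (j == b))%:R)) => //.
- by move=> x _; exact: coord_continuous.
- by move=> i j x _; exact: is_derive_coord.
- by move=> i j; exact: Ck_open_cst.
Qed.

End Ck_closure.

(** * Cutoff functions and global extensions *)

(** The truncated power $t_+^{k+1}$: $C^k$ at the origin, exactly the smoothness asked of the
    cutoff, with a derivative in the same family. *)
Definition ramp (R : realType) (k : nat) (t : R) : R := Num.max 0 t ^+ k.+1.

Lemma ramp_continuous (R : realType) (k : nat) : continuous (@ramp R k).
Proof.
move=> t; apply: (@continuous_comp _ _ _ (fun t : R => Num.max 0 t) (fun t => t ^+ k.+1)).
  by apply: (@continuous_max _ _ (fun=> 0) id); [exact: cst_continuous|exact: cvg_id].
exact: exprn_continuous.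
Qed.

Lemma ramp_le0 (R : realType) (k : nat) (t : R) : t <= 0 -> ramp k t = 0.
Proof. by move=> t0; rewrite /ramp max_l// expr0n. Qed.

Lemma ramp_ge0 (R : realType) (k : nat) (t : R) : 0 <= ramp k t.
Proof. by rewrite /ramp exprn_ge0// le_max lexx. Qed.

Lemma ramp_gt0 (R : realType) (k : nat) (t : R) : 0 < t -> 0 < ramp k t.
Proof. by move=> t0; rewrite /ramp exprn_gt0// lt_max t0 orbT. Qed.

Lemma ramp_ge1 (R : realType) (k : nat) (t : R) : 1 <= t -> 1 <= ramp k t.
Proof. by move=> t1; rewrite /ramp exprn_ege1// le_max t1 orbT. Qed.

Lemma ramp1 (R : realType) (k : nat) : ramp k (1 : R) = 1.
Proof. by rewrite /ramp max_r ?expr1n. Qed.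

Lemma is_derive_ramp (R : realType) (k : nat) (t : R) :
  is_derive t 1 (ramp k.+1) (k.+2%:R * ramp k t).
Proof.
have [t0|t0|t0] := ltgtP t 0.
- rewrite ramp_le0 ?ltW// mulr0.
  have H : is_derive t (1 : R) (cst (0 : R)) 0 by exact: is_derive_cst.
  apply: near_eq_is_derive H.
  near=> s; rewrite [RHS]ramp_le0//; near: s.
  exact: (cvgr_le t cvg_id 0 t0).
- have H : is_derive t (1 : R) (fun s : R => s ^+ k.+2) (k.+2%:R * ramp k t).
    have H := is_deriveX k.+2 (is_derive_id t (1 : R)).
    rewrite (_ : k.+2%:R * _ = (k.+2%:R * t ^+ k.+1) *: (1 : R)).
      by apply: is_derive_transport H => h; rewrite fctE.
    by rewrite /ramp max_r ?(ltW t0)// [_ *: 1]mulr1.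
  apply: near_eq_is_derive H.
  near=> s; rewrite /ramp [RHS](_ : _ = s ^+ k.+2)// max_r//; near: s.
  exact: (cvgr_ge t cvg_id 0 t0).
- rewrite t0 ramp_le0// mulr0.
  (* At 0 the difference quotient of [ramp k.+1] is [ramp k h] itself, which is continuous and
     vanishes at 0. *)
  have cv : (fun h : R => h^-1 *: ((ramp k.+1 \o shift 0) (h *: 1) - ramp k.+1 0))
      @ 0^' --> (0 : R).
    have : ramp k h @[h --> (0 : R)^'] --> (0 : R).
      have := @ramp_continuous R k 0; rewrite /continuous_at ramp_le0//.
      by apply: cvg_trans; apply: cvg_app; exact: nbhs_dnbhs.
    apply: cvg_trans; apply: near_eq_cvg; near=> h.
    rewrite /= addr0 [_ *: 1]mulr1 (ramp_le0 _ (lexx 0)) subr0.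
    have h0 : h != 0 by near: h; exact: nbhs_dnbhs_neq.
    apply: (canRL (scalerK h0)); rewrite /ramp [in RHS]exprS.
    by case: (leP 0 h) => // _; rewrite expr0n/= mul0r scaler0.
  apply: DeriveDef; first by apply/cvg_ex; exists 0.
  exact: cvg_lim cv.
Unshelve. all: by end_near. Qed.

Lemma Ck_open_ramp (R : realType) (n d k : nat) (U : set 'M[R]_(n, d))
    (S : 'M[R]_(n, d) -> R) :
  open U -> Ck_open k U S -> Ck_open k U (ramp k \o S).
Proof.
move=> oU; have cc m x : {for x, continuous S} -> {for x, continuous (ramp m \o S)}.
  by move=> Sx; apply: continuous_comp Sx _; exact: ramp_continuous.
elim: k => [|k IH] CS.
  by split=> // x Ux; apply: cc; exact: Ck_open_continuous CS Ux.
apply: (@Ck_openS _ _ _ _ _ _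
  (fun i j x => k.+2%:R * ramp k (S x) * partial i j S x)) => //.
- by move=> x Ux; apply: cc; exact: Ck_open_continuous CS Ux.
- move=> i j x Ux; apply: is_derive_comp_line; first exact: is_derive_ramp.
  exact: Ck_open_derive CS Ux.
- move=> i j; apply: Ck_openM (Ck_open_partial i j CS) => //.
  by apply: Ck_openZ => //; apply: IH; exact: Ck_open_le (leqnSn k) CS.
Qed.

(** The topology comes from the max norm, which is not smooth; the squared Euclidean distance is
    polynomial and can be fed to [ramp]. *)
Lemma sqrdist_nbhs (R : realType) (n d : nat) (U : set 'M[R]_(n, d))
    (v : 'M[R]_(n, d)) : open U -> U v ->
  exists2 r : R, 0 < r &
    forall x : 'M[R]_(n, d), \sum_i \sum_j (x i j - v i j) ^+ 2 < r -> U x.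
Proof.
move=> oU Uv; have /nbhs_ballP[e /= e0 eU] := open_nbhs_nbhs (conj oU Uv).
exists (e ^+ 2) => [|x xr]; first by rewrite exprn_gt0.
apply: eU; split=> // i j; rewrite /ball /= distrC.
rewrite -(@ltr_pXn2r _ 2)// ?nnegrE ?normr_ge0 ?ltW// real_normK ?num_real//.
apply: le_lt_trans xr; rewrite (bigD1 i)//= (bigD1 j)//= -addrA lerDl.
by rewrite addr_ge0 ?sumr_ge0// => *; rewrite ?sumr_ge0// => *; rewrite sqr_ge0.
Qed.

Lemma Ck_cutoff (R : realType) (n d k : nat) (V U : set 'M[R]_(n, d)) :
  compact V -> open U -> V `<=` U ->
  exists chi : 'M[R]_(n, d) -> R, [/\ Ck_open k setT chi,
    forall x, V x -> chi x = 1 &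
    exists K, [/\ closed K, K `<=` U & forall x, ~ K x -> chi x = 0]].
Proof.
move=> cV oU VU; have oT := @openT 'M[R]_(n, d).
have /choice[r rP] : forall v, exists r : R, V v -> 0 < r /\
    forall x : 'M[R]_(n, d), \sum_i \sum_j (x i j - v i j) ^+ 2 < r -> U x.
  move=> v; have [Vv|nV] := pselect (V v); last by exists 0.
  by have [r r0 rU] := sqrdist_nbhs oU (VU v Vv); exists r.
pose q v (x : 'M[R]_(n, d)) := r v - \sum_i \sum_j (x i j - v i j) ^+ 2.
have Cq v : Ck_open k setT (q v).
  apply: Ck_openB => //; first exact: Ck_open_cst.
  apply: Ck_open_sum => // i _; apply: Ck_open_sum => // j _.
  by apply: Ck_openM => //; apply: Ck_openB => //;
    [exact: Ck_open_coord|exact: Ck_open_cst|exact: Ck_open_coord|exact: Ck_open_cst].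
pose b v := ramp k \o q v.
have Cb v : Ck_open k setT (b v) by apply: Ck_open_ramp.
have [D DV VD] : finite_subset_cover V (fun v => [set x | 0 < b v x]) V.
  move: (cV); rewrite compact_cover; apply.
    move=> v _; apply: (@open_comp _ _ (b v) [set t | 0 < t]); last exact: open_gt.
    by move=> x _; exact: Ck_open_continuous (Cb v) _.
  move=> v Vv; exists v => //=; apply: ramp_gt0.
  rewrite /q big1 ?subr0; first exact: (rP v Vv).1.
  by move=> i _; rewrite big1// => j _; rewrite subrr expr0n.
pose S x := \sum_(v <- finmap.enum_fset D) b v x.
have CS : Ck_open k setT S by apply: Ck_open_sum.
have cS x : {for x, continuous S} by exact: Ck_open_continuous CS _.
have SU x : 0 < S x -> U x.
  move=> S0; apply/not_notP => nUx; move: S0; rewrite /S big_seq big1 ?ltxx// => v vD.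
  have Vv : V v by have := DV v vD; rewrite inE.
  apply: ramp_le0; rewrite /q subr_le0 leNgt; apply/negP => /(rP v Vv).2.
  by [].
(* The finite sum of bumps attains a positive minimum on [V]; any positive [c] serves when [V] is
   empty. *)
have [c c0 cP] : exists2 c : R, 0 < c & forall x, V x -> c <= S x.
  have [V0|V0] := pselect (V !=set0); last first.
    by exists 1 => // x Vx; case: V0; exists x.
  have [|x0 x0V xmin] := @compact_EVT_min _ _ S _ V0 cV.
    exact: continuous_subspaceT.
  exists (S x0) => [|x Vx]; last by apply: xmin; rewrite inE.
  have [v vD bv] := VD x0 (set_mem x0V).
  rewrite /S (big_rem v)//=; apply: ltr_wpDr bv.
  by apply: sumr_ge0 => w _; exact: ramp_ge0.
(* If $S\ge c$ the inner ramp is at least 1, the outer one vanishes and the value is 1. If $S\le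
   c/2$ the inner ramp vanishes, the outer one is 1 and the value is 0. *)
exists (fun x => 1 - (ramp k \o (fun x => 1 - (ramp k \o
  (fun x => 2 / c * S x - 1)) x)) x); split.
- apply: Ck_openB => //; first exact: Ck_open_cst.
  apply: Ck_open_ramp => //; apply: Ck_openB => //; first exact: Ck_open_cst.
  apply: Ck_open_ramp => //; apply: Ck_openB => //; last exact: Ck_open_cst.
  exact: Ck_openZ.
- move=> x Vx /=; rewrite [X in _ - X]ramp_le0 ?subr0// subr_le0 ramp_ge1//.
  have : c / c <= S x / c by rewrite ler_pM2r ?invr_gt0// cP.
  by rewrite divff ?gt_eqF// -mulrA [c^-1 * _]mulrC; lra.
- exists [set x | c / 2 <= S x]; split.
  + apply: (@closed_comp _ _ S [set t | c / 2 <= t]); last exact: closed_ge.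
    by move=> x _; exact: cS.
  + by move=> x /= cx; apply: SU; apply: lt_le_trans cx; rewrite divr_gt0.
  + move=> x /= /negP; rewrite -ltNge => Sx.
    rewrite [ramp k (2 / c * _ - 1)]ramp_le0 ?subr0 ?ramp1 ?subrr// subr_le0.
    have -> : 2 / c * S x = S x / (c / 2) by field; rewrite gt_eqF.
    by rewrite ler_pdivrMr ?divr_gt0// mul1r ltW.
Qed.

Lemma Ck_on_global (R : realType) (n d k : nat) (V : set 'M[R]_(n, d))
    (g : 'M[R]_(n, d) -> R) : compact V -> Ck_on k V g ->
  exists2 G, Ck_open k setT G & forall x, V x -> G x = g x.
Proof.
move=> cV [F [[U [oU VU CF]] Fg]].
have [chi [Cchi chi1 [K [cK KU chi0]]]] := Ck_cutoff k cV oU VU.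
exists (fun x => chi x * F x); last by move=> x Vx; rewrite chi1// mul1r Fg.
(* On [U] this is a product of $C^k$ functions; off [K] it is 0, whatever [F] does outside [U]. *)
rewrite (_ : setT = U `|` ~` K).
  apply: Ck_openU; first by apply: Ck_openM => //; exact: Ck_open_sub Cchi.
  apply: (@eq_Ck_open _ _ _ _ _ (fun=> 0)); first exact: closed_openC.
    by move=> x /chi0 ->; rewrite mul0r.
  by apply: Ck_open_cst; exact: closed_openC.
apply/seteqP; split=> // x _; have [/KU|] := pselect (K x); by [left|right].
Qed.

(** * Compact powers, cubes and uniform continuity *)

Lemma compact_cart_pow (R : realType) (n d : nat) (Omega : set 'rV[R]_d) :
  compact Omega -> compact (cart_pow n Omega).
Proof.
(* Read as a row of rows, $\Omega^n$ is a product of compact sets, to which Tychonoff's theorem for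
   row vectors applies. *)
move=> cO; pose h (v : 'rV['rV[R]_d]_n) : 'M[R]_(n, d) := \matrix_(i, j) v 0 i 0 j.
have -> : cart_pow n Omega = h @` [set v : 'rV['rV[R]_d]_n | forall i, Omega (v ord0 i)].
  apply/seteqP; split=> [x Ox|_ [v vO <-] i].
    exists (\row_i row i x) => [i|]; first by rewrite mxE; exact: Ox.
    by apply/matrixP => i j; rewrite !mxE.
  rewrite (_ : row i _ = v ord0 i); first exact: vO.
  by apply/rowP => j; rewrite !mxE.
apply: continuous_compact; last exact: (@rV_compact 'rV[R]_d n (fun=> Omega)).
apply: continuous_subspaceT => v A /nbhs_ballP[e /= e0 eA].
apply/nbhs_ballP; exists e => // w [_ vw]; apply: eA; split=> // i j.
by rewrite !mxE; exact: (vw ord0 i).2.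
Qed.

Definition cube (R : realType) (n d : nat) (M : R) : set 'M[R]_(n, d) :=
  [set x | forall i j, - M <= x i j <= M].

Lemma compact_cube (R : realType) (n d : nat) (M : R) : compact (@cube R n d M).
Proof.
rewrite (_ : cube M = cart_pow n [set v : 'rV[R]_d | forall j, `[- M, M]%classic (v ord0 j)]).
  apply: compact_cart_pow; apply: (@rV_compact R d (fun=> `[- M, M]%classic)) => _.
  exact: segment_compact.
apply/seteqP; split=> x xM i j.
  by rewrite /= in_itv/= mxE; exact: xM.
by have := xM i j; rewrite /= in_itv/= mxE.
Qed.

Lemma compact_sub_cube (R : realType) (n d : nat) (V : set 'M[R]_(n, d)) :
  compact V -> exists2 M : R, 0 < M & V `<=` cube M.
Proof.
move=> /compact_bounded[M0 [M0r M0V]].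
exists (Num.max M0 0 + 1) => [|x Vx i j]; first by rewrite ltr_wpDl// le_max lexx orbT.
rewrite -ler_norml; apply: le_trans (M0V (Num.max M0 0 + 1) _ x Vx).
  rewrite [leRHS]/Num.norm /= mx_normrE; apply/bigmax_geP; right => /=.
  by exists (i, j).
by rewrite ltr_pwDr// le_max lexx.
Qed.

(** The near-covering form of compactness turns the local moduli (with [e / 2]) into a common [dl];
    only [x] is required to lie in [K]. *)
Lemma compact_unif_near (R : realType) (n d : nat) (K : set 'M[R]_(n, d))
    (g : 'M[R]_(n, d) -> R) (e : R) :
  compact K -> continuous g -> 0 < e ->
  exists2 dl : R, 0 < dl & forall x y : 'M[R]_(n, d), K x ->
    (forall i j, `|x i j - y i j| < dl) -> `|g x - g y| <= e.
Proof.
move=> /compact_near_coveringP cK cg e0.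
pose P (dl : R) (x : 'M[R]_(n, d)) := forall y : 'M[R]_(n, d),
  (forall i j, `|x i j - y i j| < dl) -> `|g x - g y| <= e.
have H : forall x, K x -> \forall x' \near x & dl \near 0^'+, P dl x'.
  move=> x Kx.
  have /cvgrPdist_le/(_ (e / 2)) := cg x; rewrite divr_gt0// => /(_ isT).
  move=> /nbhs_ballP[r /= r0 rP].
  exists (ball x (r / 2), [set t | t < r / 2]).
    split; first by apply: nbhsx_ballx; rewrite divr_gt0.
    by apply: nbhs_right_lt; rewrite divr_gt0.
  move=> [x' t] /= [[_ xx'] tr] y x'y.
  have r2 : r / 2 <= r by lra.
  have := rP x' (conj r0 (fun i j => le_ball r2 (xx' i j))).
  have : ball x r y.
    split=> // i j; rewrite /ball/=.
    have := xx' i j; have := x'y i j; rewrite /ball/=.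
    move: (x i j) (x' i j) (y i j) => a b c bc ab.
    by have := ler_distD b a c; lra.
  move=> /rP /=; move: (g x) (g x') (g y) => a b c ac ab.
  by have := ler_distD a b c; rewrite [`|b - a|]distrC; lra.
have Hn : \forall dl \near 0^'+, K `<=` P dl by apply: cK.
have : \forall dl \near (0 : R)^'+, 0 < dl /\ K `<=` P dl.
  by near=> dl; split; [near: dl; exact: nbhs_right_gt | near: dl].
by move=> /filter_ex[dl [dl0 dlP]]; exists dl => // x y Kx; exact: dlP.
Unshelve. all: by end_near. Qed.

(** * Mixed derivatives, reparametrizations and difference quotients *)

(** Mean value theorem twice: along [u] for the increment of [f] by [r *: v], then along [v] for
    ['D_u f]. *)
Lemma second_difference (R : realType) (V : normedModType R) (f : V -> R)
    (u v x : V) (r : R) : 0 < r ->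
  (forall y, derivable f y u) -> (forall y, derivable ('D_u f) y v) ->
  exists s t, [/\ 0 <= s <= r, 0 <= t <= r &
    f (r *: u + (r *: v + x)) - f (r *: u + x) - (f (r *: v + x) - f x)
      = 'D_v ('D_u f) (t *: v + (s *: u + x)) * r * r].
Proof.
move=> r0 df ddf.
pose phi (s : R) := f (s *: u + (r *: v + x)) - f (s *: u + x).
have dphi (s : R) : is_derive s 1 phi
    ('D_u f (s *: u + (r *: v + x)) - 'D_u f (s *: u + x)).
  by apply: is_deriveB; apply: is_derive_line; exact: df.
have [|s] := MVT r0 (fun s _ => dphi s).
  apply: continuous_subspaceT => s; apply/differentiable_continuous.
  by apply/derivable1_diffP; exact: ex_derive.
rewrite in_itv/= subr0 => /andP[/ltW s0 /ltW sr] Es.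
pose psi (t : R) := 'D_u f (t *: v + (s *: u + x)).
have dpsi (t : R) : is_derive t 1 psi ('D_v ('D_u f) (t *: v + (s *: u + x))).
  exact: is_derive_line.
have [|t] := MVT r0 (fun t _ => dpsi t).
  apply: continuous_subspaceT => t; apply/differentiable_continuous.
  by apply/derivable1_diffP; exact: ex_derive.
rewrite in_itv/= subr0 => /andP[/ltW t0 /ltW tr] Et.
exists s, t; split; rewrite ?s0 ?t0//.
rewrite -Et /psi scale0r add0r.
by move: Es; rewrite /phi !scale0r !add0r => ->; rewrite [s *: u + (r *: v + x)]addrCA.
Qed.

Lemma ler_dist_half (R : realFieldType) (a b m e : R) :
  `|a - m| <= e / 2 -> `|b - m| <= e / 2 -> `|a - b| <= e.
Proof.
by move=> am bm; rewrite [e]splitr (le_trans (ler_distD m _ _))// lerD// distrC.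
Qed.

(** Schwarz's theorem: the second difference is symmetric in [u] and [v], so the two mixed
    derivatives agree at points arbitrarily close to [x]. *)
Lemma derive_symm (R : realType) (V : normedModType R) (f : V -> R) (u v x : V) :
  (forall y, derivable f y u) -> (forall y, derivable f y v) ->
  (forall y, derivable ('D_u f) y v) -> (forall y, derivable ('D_v f) y u) ->
  {for x, continuous ('D_v ('D_u f))} -> {for x, continuous ('D_u ('D_v f))} ->
  'D_v ('D_u f) x = 'D_u ('D_v f) x.
Proof.
move=> du dv duv dvu cuv cvu.
apply/eqP; rewrite -subr_eq0 -normr_le0; apply/ler_addgt0Pr => e e0; rewrite add0r.
have e2 : 0 < e / 2 by rewrite divr_gt0.
have /cvgrPdist_le/(_ _ e2) Nuv := cuv; have /cvgrPdist_le/(_ _ e2) Nvu := cvu.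
move/nbhs_normP: Nuv => [dl1 /= dl10 dl1P]; move/nbhs_normP: Nvu => [dl2 /= dl20 dl2P].
pose dl := Num.min dl1 dl2.
have dl0 : 0 < dl by rewrite lt_min dl10.
pose c := `|u| + `|v| + 1.
have c0 : 0 < c by rewrite /c -addrA ltr_wpDl// ltr_wpDl.
(* The intermediate points are within [r * c], that is [dl / 2], of [x]. The 1 in [c] keeps the
   denominator positive when [u] and [v] vanish. *)
pose r := dl / (2 * c).
have r0 : 0 < r by rewrite divr_gt0// mulr_gt0.
have near_x (w w' : V) s t : `|w| + `|w'| + 1 = c -> 0 <= s <= r -> 0 <= t <= r ->
    `|x - (t *: w' + (s *: w + x))| < dl1 /\ `|x - (t *: w' + (s *: w + x))| < dl2.
  move=> wc /andP[s0 sr] /andP[t0 tr]; apply/andP; rewrite -lt_min.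
  rewrite addrA opprD addrCA subrr addr0 normrN (le_lt_trans (ler_normD _ _))//.
  rewrite !normrZ !ger0_norm//.
  have : t * `|w'| + s * `|w| <= r * c.
    rewrite -wc; have := ler_wpM2r (normr_ge0 w') tr.
    by have := ler_wpM2r (normr_ge0 w) sr; nra.
  rewrite -/dl; have -> : r * c = dl / 2 by rewrite /r; field; rewrite gt_eqF.
  by lra.
have [s [t [hs ht E]]] := @second_difference _ _ _ _ _ x _ r0 du duv.
have [s' [t' [hs' ht' E']]] := @second_difference _ _ _ _ _ x _ r0 dv dvu.
have EE : 'D_v ('D_u f) (t *: v + (s *: u + x)) = 'D_u ('D_v f) (t' *: u + (s' *: v + x)).
  apply: (mulIf (lt0r_neq0 r0)); apply: (mulIf (lt0r_neq0 r0)).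
  rewrite [r *: v + (r *: u + x)]addrCA in E'.
  etransitivity; first exact: esym E.
  etransitivity; last exact: E'.
  by move: (f _) (f _) (f _) (f _) => p q p' q'; rewrite !opprB addrACA [RHS]addrACA [- q + _]addrC.
have := dl1P _ (near_x u v s t erefl hs ht).1.
have cE : `|v| + `|u| + 1 = c by rewrite /c [`|v| + _]addrC.
have := dl2P _ (near_x v u s' t' cE hs' ht').2.
rewrite -EE => /= bm am; exact: ler_dist_half am bm.
Qed.

Section Ck_composition.
Context {R : realType} {n d : nat}.
Implicit Types (F : 'M[R]_(n, d) -> R) (k : nat).

Lemma partialC F i j a b : Ck_open 2 setT F ->
  partial i j (partial a b F) = partial a b (partial i j F).
Proof.
move=> CF; apply/funext => x.
have d1 i' j' y : derivable F y (delta_mx i' j').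
  by case: (Ck_open_derive i' j' CF (I : setT y)).
have C2 i' j' := Ck_open_partial i' j' CF.
have d2 i' j' a' b' y : derivable (partial a' b' F) y (delta_mx i' j').
  by case: (Ck_open_derive i' j' (C2 a' b') (I : setT y)).
apply: derive_symm; [exact: d1|exact: d1|exact: d2|exact: d2| |].
  exact: Ck_open_continuous (Ck_open_partial i j (C2 a b)) (I : setT x).
exact: Ck_open_continuous (Ck_open_partial a b (C2 i j)) (I : setT x).
Qed.

(** Lets a derivative in another coordinate reach [F] itself, as the induction in [bern_op_Ck_bound]
    requires. *)
Lemma partial_iterC F i j a b r : Ck_open r.+1 setT F ->
  partial i j (iter r (partial a b) F) = iter r (partial a b) (partial i j F).
Proof.
elim: r F => [//|r IH] F CF.
rewrite iterS partialC; last first.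
  by apply: Ck_open_iter; rewrite addn2.
by rewrite IH//; exact: Ck_open_le CF.
Qed.

(* [tau i j] is the direction into which A maps the direction (i, j), if any. *)
Definition slides (A : 'M[R]_(n, d) -> 'M[R]_(n, d))
    (tau : 'I_n -> 'I_d -> option ('I_n * 'I_d)) :=
  forall i j (h : R) x,
    A (h *: delta_mx i j + x) = h *: oapp (fun p => delta_mx p.1 p.2) 0 (tau i j) + A x.

Definition opartial (p : option ('I_n * 'I_d)) F : 'M[R]_(n, d) -> R :=
  oapp (fun q => partial q.1 q.2 F) (fun=> 0) p.

(** A single chain rule for translations, row permutations and substitution of a coordinate. Each
    sends a coordinate line to a coordinate line or to a point, so partial derivatives suffice. *)
Lemma is_derive_slides A tau F i j x : slides A tau ->
  (forall i j, derivable F (A x) (delta_mx i j)) ->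
  is_derive x (delta_mx i j) (F \o A) (opartial (tau i j) F (A x)).
Proof.
move=> At dF; have := At i j; rewrite /opartial; case: (tau i j) => [p|] /= Aij.
  apply: is_derive_transport (derivableP (dF p.1 p.2)) => h /=.
  by rewrite Aij.
apply: (@is_derive_transport _ _ _ _ (cst (F (A x))) _ x (delta_mx i j)).
by move=> h; rewrite /= Aij scaler0 add0r.
Qed.

Lemma partial_slides A tau F i j k : slides A tau -> Ck_open k.+1 setT F ->
  partial i j (F \o A) = opartial (tau i j) F \o A.
Proof.
move=> At CF; apply/funext => x.
have [||_ E] := @is_derive_slides A tau F i j x => //.
by move=> a b; case: (Ck_open_derive a b CF (I : setT (A x))).
Qed.

Lemma Ck_open_slides A tau F k : continuous A -> slides A tau ->
  Ck_open k setT F -> Ck_open k setT (F \o A).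
Proof.
move=> cA At; have cc G m x : Ck_open m setT G -> {for x, continuous (G \o A)}.
  move=> CG; apply: continuous_comp; first exact: cA.
  exact: Ck_open_continuous CG I.
elim: k F => [|k IH] F CF; first by split=> // x _; exact: cc CF.
apply: (@Ck_openS _ _ _ _ _ _ (fun i j => opartial (tau i j) F \o A)) => //.
- exact: openT.
- by move=> x _; exact: cc CF.
- move=> i j x _; apply: is_derive_slides => // a b.
  by case: (Ck_open_derive a b CF (I : setT (A x))).
- move=> i j; rewrite /opartial; case: (tau i j) => [p|] /=.
    by apply: IH; exact: Ck_open_partial.
  by apply: Ck_open_cst; exact: openT.
Qed.

Lemma slides_shift (w : 'M[R]_(n, d)) : slides (fun x => x + w) (fun i j => Some (i, j)).
Proof. by move=> i j h x /=; rewrite addrA. Qed.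

Lemma row_perm_continuous (s : 'S_n) :
  continuous (row_perm s : 'M[R]_(n, d) -> 'M[R]_(n, d)).
Proof.
move=> x A /nbhs_ballP[e /= e0 eA]; apply/nbhs_ballP; exists e => // y [_ xy].
by apply: eA; split=> // i j; rewrite !mxE; exact: xy.
Qed.

Lemma slides_row_perm (s : 'S_n) : slides (row_perm s) (fun i j => Some ((s^-1)%g i, j)).
Proof.
move=> i j h x; apply/matrixP => a b; rewrite !mxE /=; congr (_ * (_ && _)%:R + _).
by apply/eqP/eqP => [<-|->]; rewrite ?permK ?permKV.
Qed.

Definition subst_coord (i : 'I_n) (j : 'I_d) (t : R) (x : 'M[R]_(n, d)) : 'M[R]_(n, d) :=
  x + (t - x i j) *: delta_mx i j.

Lemma subst_coordE i j t x a b :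
  subst_coord i j t x a b = if (a == i) && (b == j) then t else x a b.
Proof.
rewrite !mxE; case: andP => [[/eqP-> /eqP->]|_]; last by rewrite mulr0 addr0.
by rewrite mulr1 addrC subrK.
Qed.

Lemma subst_coord_continuous i j t : continuous (subst_coord i j t).
Proof.
move=> x A /nbhs_ballP[e /= e0 eA]; apply/nbhs_ballP; exists e => // y [_ xy].
apply: eA; split=> // a b; rewrite !subst_coordE.
by case: ifP => // _; exact: ballxx.
Qed.

Lemma slides_subst_coord i j t : slides (subst_coord i j t)
  (fun a b => if (a == i) && (b == j) then None else Some (a, b)).
Proof.
move=> a b h x; apply/matrixP => a' b'.
rewrite [LHS]subst_coordE [RHS]mxE [X in _ = _ + X]subst_coordE !mxE.
have [/andP[/eqP-> /eqP->]|nab] := boolP ((a == i) && (b == j)).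
  rewrite /= mxE mulr0 add0r; case: ifP => // ->.
  by rewrite mulr0 add0r.
rewrite /= mxE; case: ifP => // /andP[/eqP-> /eqP->].
by rewrite eq_sym [j == b]eq_sym (negbTE nab) mulr0 add0r.
Qed.

Definition quotient_diff (h : R) (i : 'I_n) (j : 'I_d) F : 'M[R]_(n, d) -> R :=
  fun x => (F (x + h *: delta_mx i j) - F x) / h.

Lemma Ck_open_quotient_diff h i j F k :
  Ck_open k setT F -> Ck_open k setT (quotient_diff h i j F).
Proof.
move=> CF; have oT := @openT 'M[R]_(n, d).
rewrite (_ : quotient_diff _ _ _ _ = fun x =>
    h^-1 * ((F \o (fun x => x + h *: delta_mx i j)) x - F x)); last first.
  by apply/funext => x; rewrite mulrC.
apply: Ck_openZ => //; apply: Ck_openB => //.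
apply: (Ck_open_slides _ (slides_shift _)) => //.
move=> x A /nbhs_ballP[e /= e0 eA]; apply/nbhs_ballP; exists e => // y [_ xy].
apply: eA; split=> // a b; have := xy a b.
by rewrite /ball /= !mxE opprD addrACA subrr addr0.
Qed.

Lemma partial_quotient_diff h i j a b F k : Ck_open k.+1 setT F ->
  partial a b (quotient_diff h i j F) = quotient_diff h i j (partial a b F).
Proof.
move=> CF; apply/funext => x.
have dF y : is_derive y (delta_mx a b) F (partial a b F y).
  exact: Ck_open_derive CF I.
have dS : is_derive x (delta_mx a b) (fun x => F (x + h *: delta_mx i j))
    (partial a b F (x + h *: delta_mx i j)).
  by apply: is_derive_transport (dF (x + h *: delta_mx i j)) => t; rewrite addrA.
have H := is_deriveZ h^-1 (is_deriveB dS (dF x)).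
suff : is_derive x (delta_mx a b) (quotient_diff h i j F)
    (quotient_diff h i j (partial a b F) x) by case.
rewrite {2}/quotient_diff mulrC.
by apply: is_derive_transport H => t; rewrite /quotient_diff mulrC.
Qed.

Lemma iter_partial_quotient_diff h i j a b F r : Ck_open r setT F ->
  iter r (partial a b) (quotient_diff h i j F) = quotient_diff h i j (iter r (partial a b) F).
Proof.
elim: r F => [//|r IH] F CF; rewrite iterSr (partial_quotient_diff _ _ _ _ _ CF).
by rewrite IH ?iterSr//; exact: Ck_open_partial.
Qed.

Lemma iter_quotient_diffC h i j a b F r k : Ck_open k.+1 setT F ->
  partial a b (iter r (quotient_diff h i j) F) = iter r (quotient_diff h i j) (partial a b F).
Proof.
move=> CF; elim: r => //= r <-; rewrite (@partial_quotient_diff _ _ _ _ _ _ k)//.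
by elim: r => // r IHr; rewrite iterS; exact: Ck_open_quotient_diff.
Qed.

(** Difference quotients commute with derivatives, so induction applies to the quotient of [F] and
    the mean value theorem removes the last quotient. The bound [r%:R * h] later keeps the point
    inside the cube. *)
Lemma quotient_diff_mean h i j F r x : 0 < h -> Ck_open r setT F ->
  exists2 t, 0 <= t <= r%:R * h &
    iter r (quotient_diff h i j) F x = iter r (partial i j) F (x + t *: delta_mx i j).
Proof.
move=> h0; elim: r F => [|r IH] F CF.
  by exists 0; rewrite ?mul0r ?lexx// scale0r addr0.
have CF' := Ck_open_le (leqnSn r) CF.
have [t /andP[t0 tr] E] := IH _ (Ck_open_quotient_diff h i j CF').
rewrite iterSr E iter_partial_quotient_diff//.
set G := iter r _ F; set y := x + _.
have CG : Ck_open 1 setT G by apply: Ck_open_iter; rewrite addn1.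
have dG z : derivable G z (delta_mx i j).
  by case: (Ck_open_derive i j CG (I : setT z)).
have dl (s : R) := is_derive_line (dG (s *: delta_mx i j + y)).
have [|s] := MVT h0 (fun s _ => dl s).
  apply: continuous_subspaceT => s; apply/differentiable_continuous.
  by apply/derivable1_diffP; exact: ex_derive.
rewrite in_itv/= scale0r add0r subr0 => /andP[s0 sh] Es.
exists (t + s); first by rewrite mulrSr mulrDl mul1r; lra.
rewrite /quotient_diff [y + _]addrC Es mulfK ?gt_eqF//.
by have -> : x + (t + s) *: delta_mx i j = s *: delta_mx i j + y
  by rewrite /y scalerDl addrA [RHS]addrC.
Qed.

End Ck_composition.

(** * Bernstein operators *)

(* De Casteljau's form of the Bernstein operator: [bern N a u] is the sum of
   the [a m * 'C(N, m) * u ^+ m * (1 - u) ^+ (N - m)]. *)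
Fixpoint bern (R : realType) (N : nat) (a : nat -> R) (u : R) : R :=
  if N is N'.+1 then
    (1 - u) * bern N' a u + u * bern N' (fun m => a m.+1) u
  else a 0%N.

Section bernstein.
Context {R : realType}.
Implicit Types (a b : nat -> R) (u c : R) (N m : nat).

Lemma bernD N a b u : bern N (fun m => a m + b m) u = bern N a u + bern N b u.
Proof. by elim: N a b => [//|N IH] a b /=; rewrite !IH; ring. Qed.

Lemma bernZ N c a u : bern N (fun m => c * a m) u = c * bern N a u.
Proof. by elim: N a => [//|N IH] a /=; rewrite !IH; ring. Qed.

Lemma bernB N a b u : bern N (fun m => a m - b m) u = bern N a u - bern N b u.
Proof. by elim: N a b => [//|N IH] a b /=; rewrite !IH; ring. Qed.

Lemma bern_cst N c u : bern N (fun=> c) u = c.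
Proof. by elim: N => [//|N IH] /=; rewrite !IH; ring. Qed.

Lemma bern_le N a b u : 0 <= u <= 1 -> (forall m, (m <= N)%N -> a m <= b m) ->
  bern N a u <= bern N b u.
Proof.
move=> /andP[u0 u1]; elim: N a b => [|N IH] a b ab /=; first exact: ab.
apply: lerD; apply: ler_wpM2l; rewrite ?subr_ge0//; apply: IH => m mN; apply: ab => //.
exact: leqW.
Qed.

Lemma bern_norm_le N a b u : 0 <= u <= 1 ->
  (forall m, (m <= N)%N -> `|a m| <= b m) -> `|bern N a u| <= bern N b u.
Proof.
move=> u01 ab; rewrite ler_norml -mulN1r -bernZ.
by rewrite !bern_le// => m /ab; rewrite ler_norml ?mulN1r => /andP[].
Qed.

(** First moment of the binomial law; with the second moment in [bern_sqr] it gives the variance. *)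
Lemma bern_id N u : bern N (fun m => m%:R) u = N%:R * u.
Proof.
elim: N => [|N IH] /=; first by rewrite mul0r.
rewrite (_ : (fun m => m.+1%:R) = fun m : nat => m%:R + 1); last first.
  by apply/funext => m; rewrite -natr1.
by rewrite bernD bern_cst IH -natr1; ring.
Qed.

Lemma bern_sqr N u :
  bern N (fun m => m%:R ^+ 2) u = N%:R * u + N%:R * (N%:R - 1) * u ^+ 2.
Proof.
elim: N => [|N IH] /=; first by rewrite !mul0r expr0n addr0.
rewrite (_ : (fun m => m.+1%:R ^+ 2) = fun m : nat => m%:R ^+ 2 + (2 * m%:R + 1)); last first.
  by apply/funext => m; rewrite -natr1; ring.
by rewrite bernD bernD bernZ bern_cst bern_id IH -natr1; ring.
Qed.

(** Binomial weights of degree [L] on nodes $m/N$: the variance is $Lu(1-u)/N^2$ and, since $L=N-r$,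
    the bias is $-ru/N$. The left side is variance plus squared bias. *)
Lemma bern_sqr_dev L N r u : (0 < N)%N -> (L + r = N)%N -> 0 <= u <= 1 ->
  bern L (fun m => (m%:R / N%:R - u) ^+ 2) u <= (r%:R ^+ 2 + 1) / N%:R.
Proof.
move=> N0 LrN /andP[u0 u1].
rewrite (_ : (fun m => _) = fun m : nat =>
    (N%:R ^+ 2)^-1 * m%:R ^+ 2 - (2 * u / N%:R * m%:R - u ^+ 2)); last first.
  by apply/funext => m; field; rewrite pnatr_eq0 -lt0n.
rewrite bernB bernB !bernZ bern_cst bern_id bern_sqr.
have N1 : 1 <= N%:R :> R by rewrite ler1n.
have L0 : 0 <= L%:R :> R by [].
have r0 : 0 <= r%:R :> R by [].
have NE : N%:R = L%:R + r%:R :> R by rewrite -natrD LrN.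
have r2 : u ^+ 2 * r%:R ^+ 2 <= r%:R ^+ 2 * N%:R.
  have : u ^+ 2 <= 1 by rewrite expr_le1.
  by have := sqr_ge0 (r%:R : R); nra.
have Lu : L%:R * (u * (1 - u)) <= N%:R by nra.
rewrite -(@ler_pM2r _ (N%:R ^+ 2)); last by rewrite exprn_gt0// (lt_le_trans _ N1).
have -> : (r%:R ^+ 2 + 1) / N%:R * N%:R ^+ 2 = (r%:R ^+ 2 + 1) * N%:R :> R.
  by field; rewrite pnatr_eq0 -lt0n.
rewrite (_ : _ * N%:R ^+ 2 = u ^+ 2 * r%:R ^+ 2 + L%:R * (u * (1 - u))); last first.
  have -> : r%:R = N%:R - L%:R :> R by rewrite NE; ring.
  by field; rewrite pnatr_eq0 -lt0n.
by lra.
Qed.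

Lemma is_derive_bern N a u :
  is_derive u 1 (bern N a) (N%:R * bern N.-1 (fun m => a m.+1 - a m) u).
Proof.
elim: N a => [|N IH] a; first by rewrite mul0r; exact: is_derive_cst.
have d1 : is_derive u (1 : R) (fun t : R => 1 - t) (0 - 1).
  exact: (is_deriveB (is_derive_cst (1 : R) u 1) (is_derive_id u 1)).
have H := is_deriveD (is_deriveM d1 (IH a))
  (is_deriveM (is_derive_id u (1 : R)) (IH (fun m => a m.+1))).
set D := fun m => a m.+1 - a m.
(* De Casteljau's recursion in degree [N]; for [N = 0], where [N.-1] is again 0, the factor [N%:R]
   makes both sides vanish. *)
have E : N%:R * ((1 - u) * bern N.-1 D u + u * bern N.-1 (fun m => D m.+1) u) =
    N%:R * bern N D u by case: N {IH H} => //; rewrite !mul0r.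
have DB : bern N D u = bern N (fun m => a m.+1) u - bern N a u by rewrite bernB.
rewrite (_ : _ * _ = (1 - u) *: (N%:R * bern N.-1 D u) + bern N a u *: (0 - 1) +
    (u *: (N%:R * bern N.-1 (fun m => D m.+1) u) +
      bern N (fun m => a m.+1) u *: (1 : R))); first exact: is_derive_transport H.
rewrite -natr1 mulrDl mul1r -E DB /GRing.scale /=; ring.
Qed.

(** The product of the factors $(N-l)\,h/(2M)$, with $h=2M/N$, that $r$ successive derivatives of a
    Bernstein operator bring out. *)
Definition falling_ratio (N r : nat) : R := \prod_(l < r) ((N - l)%:R / N%:R).

(** Multiplying a number in $[0,1]$ by $1-r/N$ costs at most $r/N$, and $r^2+r\le(r+1)^2$. *)
Lemma falling_ratio_bounds N r : (r <= N)%N -> (0 < N)%N ->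
  1 - r%:R ^+ 2 / N%:R <= falling_ratio N r <= 1.
Proof.
rewrite /falling_ratio => + N0; elim: r => [|r IH] rN.
  by rewrite big_ord0 expr0n mul0r subr0 lexx.
rewrite big_ord_recr/=; have /andP[] := IH (ltnW rN).
have N0' : 0 < N%:R :> R by rewrite ltr0n.
set p := \prod_(_ < _) _ => p1 p2.
have p0 : 0 <= p by apply: prodr_ge0 => l _; rewrite divr_ge0.
rewrite natrB ?(ltnW rN)// mulrBl divff ?gt_eqF//.
have rN' : 0 <= (r%:R / N%:R : R) <= 1.
  by rewrite divr_ge0//= ler_pdivrMr// mul1r ler_nat ltnW.
rewrite -natr1 sqrrD mulr1 expr1n !mulrDl; set q := r%:R / N%:R in rN' *.
have N1 : 0 <= 1 / N%:R :> R by rewrite divr_ge0.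
move: p1; set s := r%:R ^+ 2 / N%:R => p1.
by apply/andP; split; nra.
Qed.

Lemma near_infty_div_le (A e : R) : 0 < e -> \forall N \near \oo, A / N%:R <= e.
Proof.
move=> e0; near=> N; have N0 : (0 < N)%N by near: N; exact: nbhs_infty_gt.
rewrite ler_pdivrMr ?ltr0n// mulrC -ler_pdivrMr//.
by near: N; exact: nbhs_infty_ger.
Unshelve. all: by end_near. Qed.

End bernstein.

Section bernstein_operator.
Context {R : realType} {n d : nat}.
Context (i : 'I_n) (j : 'I_d) (M : R).
Implicit Types (F G : 'M[R]_(n, d) -> R) (k : nat).

Definition unit_coord (x : 'M[R]_(n, d)) : R := (2 * M)^-1 * (x i j + M).

(** Degree [L] and spacing [h] are independent because a derivative lowers the degree but leaves the
    nodes where they are. *)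
Definition bern_op (L : nat) (h : R) G : 'M[R]_(n, d) -> R :=
  fun x => bern L (fun m => G (subst_coord i j (m%:R * h - M) x)) (unit_coord x).

Lemma unit_coord_itv x : 0 < M -> cube M x -> 0 <= unit_coord x <= 1.
Proof.
move=> M0 /(_ i j)/andP[Mx xM]; have M2 : 0 < 2 * M by rewrite mulr_gt0.
by rewrite /unit_coord mulr_ge0 ?invr_ge0 ?(ltW M2)//= ?ler_pdivrMl//; lra.
Qed.

Lemma is_derive_unit_coord a b x :
  is_derive x (delta_mx a b) unit_coord
    ((2 * M)^-1 * ((a == i) && (b == j))%:R).
Proof.
have H := is_deriveZ (2 * M)^-1 (is_deriveD (is_derive_coord i j a b x)
  (is_derive_cst (M : R) x (delta_mx a b))).
by rewrite addr0 in H; apply: is_derive_transport H.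
Qed.

Lemma is_derive_bern_seq N (a : nat -> 'M[R]_(n, d) -> R) (da : nat -> R) x v u :
  (forall m, is_derive x v (a m) (da m)) ->
  is_derive x v (fun y => bern N (a^~ y) u) (bern N da u).
Proof.
elim: N a da => [|N IH] a da ada /=; first exact: ada.
have H := is_deriveD (is_deriveZ (1 - u) (IH _ _ ada))
  (is_deriveZ u (IH (fun m => a m.+1) (fun m => da m.+1) (fun m => ada m.+1))).
exact: is_derive_transport H.
Qed.

Lemma Ck_open_bern N (a : nat -> 'M[R]_(n, d) -> R) (S : 'M[R]_(n, d) -> R) k :
  (forall m, Ck_open k setT (a m)) -> Ck_open k setT S ->
  Ck_open k setT (fun x => bern N (a^~ x) (S x)).
Proof.
move=> + CS; have oT := @openT 'M[R]_(n, d).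
elim: N a => [|N IH] a Ca /=; first exact: Ca.
apply: Ck_openD => //; apply: Ck_openM => //; last exact: (IH (fun m => a m.+1)).
  by apply: Ck_openB => //; exact: Ck_open_cst.
exact: IH.
Qed.

Lemma Ck_open_unit_coord k : Ck_open k setT unit_coord.
Proof.
have oT := @openT 'M[R]_(n, d).
apply: Ck_openZ => //; apply: Ck_openD => //; first exact: Ck_open_coord.
exact: Ck_open_cst.
Qed.

Lemma Ck_open_subst_coord t G k : Ck_open k setT G ->
  Ck_open k setT (fun x => G (subst_coord i j t x)).
Proof.
exact: Ck_open_slides (@subst_coord_continuous _ _ _ _ _ _) (slides_subst_coord _ _ _).
Qed.

Lemma Ck_open_bern_op L h G k : Ck_open k setT G -> Ck_open k setT (bern_op L h G).
Proof.
move=> CG; apply: Ck_open_bern; last exact: Ck_open_unit_coord.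
by move=> m; exact: Ck_open_subst_coord.
Qed.

Lemma partial_bern_op_neq L h G a b k : (a, b) != (i, j) -> Ck_open k.+1 setT G ->
  partial a b (bern_op L h G) = bern_op L h (partial a b G).
Proof.
move=> ne CG; apply/funext => x; rewrite /partial.
pose A m := subst_coord i j (m%:R * h - M).
have dA m : is_derive x (delta_mx a b) (G \o A m) (partial a b G (A m x)).
  have := @is_derive_slides _ _ _ _ _ G a b x (slides_subst_coord i j (m%:R * h - M)).
  rewrite xpair_eqE in ne; rewrite (negbTE ne); apply => a' b'.
  by case: (Ck_open_derive a' b' CG (I : setT (A m x))).
have [_ E] : is_derive x (delta_mx a b) (bern_op L h G)
    (bern L (fun m => partial a b G (A m x)) (unit_coord x)).
  have := @is_derive_bern_seq L (fun m => G \o A m) _ x (delta_mx a b) (unit_coord x) dA.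
  apply: is_derive_transport => t; rewrite /bern_op; congr bern.
  rewrite /unit_coord !mxE; rewrite xpair_eqE in ne.
  by rewrite [i == a]eq_sym [j == b]eq_sym (negbTE ne) mulr0 add0r.
exact: E.
Qed.

Lemma subst_coord_add t h (x : 'M[R]_(n, d)) :
  subst_coord i j (t + h) x = subst_coord i j t x + h *: delta_mx i j.
Proof. by rewrite /subst_coord [t + h - _]addrAC scalerDl addrA. Qed.

Lemma subst_coord_id t h (x : 'M[R]_(n, d)) :
  subst_coord i j t (h *: delta_mx i j + x) = subst_coord i j t x.
Proof. by rewrite slides_subst_coord !eqxx /= scaler0 add0r. Qed.

(** The nodes overwrite coordinate $(i,j)$, which therefore enters only through [unit_coord]. The
    forward differences of the coefficients are [h] times difference quotients at the nodes. *)
Lemma partial_bern_op L h G : h != 0 ->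
  partial i j (bern_op L h G) =
  fun x => L%:R * (h / (2 * M)) * bern_op L.-1 h (quotient_diff h i j G) x.
Proof.
move=> h0; apply/funext => x; rewrite /partial.
pose a m := G (subst_coord i j (m%:R * h - M) x).
have dS := is_derive_unit_coord i j x; rewrite !eqxx mulr1 in dS.
have [_ E] : is_derive x (delta_mx i j) (bern_op L h G)
    (L%:R * bern L.-1 (fun m => a m.+1 - a m) (unit_coord x) * (2 * M)^-1).
  have := is_derive_comp_line (is_derive_bern L a (unit_coord x)) dS.
  apply: is_derive_transport => t; rewrite /bern_op /=; congr bern.
  by apply/funext => m; rewrite subst_coord_id.
rewrite E.
have -> : (fun m => a m.+1 - a m) = fun m => h *
    quotient_diff h i j G (subst_coord i j (m%:R * h - M) x).
  apply/funext => m; rewrite /quotient_diff mulrC divfK// -subst_coord_add.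
  by rewrite /a -natr1 mulrDl mul1r addrAC.
by rewrite bernZ /bern_op; ring.
Qed.

End bernstein_operator.

(** * Uniform bounds on derivatives *)

Section Ck_bound.
Context {R : realType} {n d : nat}.
Implicit Types (F G : 'M[R]_(n, d) -> R) (k : nat) (M e : R).

(** Bounds iterated partials in every order of differentiation, so that it recurses on first
    derivatives as [Ck_open] does; [Ck_bound_Dmulti] extracts the multi-index derivatives. *)
Fixpoint Ck_bound k M e F : Prop :=
  (forall x, cube M x -> `|F x| <= e) /\
  (if k is k'.+1 then forall i j, Ck_bound k' M e (partial i j F) else True).

Lemma Ck_bound_norm k M e F x : Ck_bound k M e F -> cube M x -> `|F x| <= e.
Proof. by case: k => [|k] [+ _]; apply. Qed.

Lemma Ck_bound_pred k M e F : Ck_bound k.+1 M e F -> Ck_bound k M e F.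
Proof.
elim: k F => [|k IH] F [bF dF]; first by [].
by split=> // i j; apply: IH; exact: dF.
Qed.

Lemma Ck_bound_le k M e e' F : e <= e' -> Ck_bound k M e F -> Ck_bound k M e' F.
Proof.
move=> ee'; elim: k F => [|k IH] F [bF dF]; (split; first by move=> x /bF /le_trans; apply) => //.
by move=> i j; exact: IH (dF i j).
Qed.

Lemma partialD F G i j k : Ck_open k.+1 setT F -> Ck_open k.+1 setT G ->
  partial i j (fun x => F x + G x) = fun x => partial i j F x + partial i j G x.
Proof.
move=> CF CG; apply/funext => x.
by case: (is_deriveD (Ck_open_derive i j CF (I : setT x)) (Ck_open_derive i j CG I)).
Qed.

Lemma partialM F G i j k : Ck_open k.+1 setT F -> Ck_open k.+1 setT G ->
  partial i j (fun x => F x * G x) =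
  fun x => F x * partial i j G x + G x * partial i j F x.
Proof.
move=> CF CG; apply/funext => x.
by case: (is_deriveM (Ck_open_derive i j CF (I : setT x)) (Ck_open_derive i j CG I)).
Qed.

Lemma partialZ c F i j k : Ck_open k.+1 setT F ->
  partial i j (fun x => c * F x) = fun x => c * partial i j F x.
Proof.
move=> CF; apply/funext => x.
by case: (is_deriveZ c (Ck_open_derive i j CF (I : setT x))).
Qed.

Lemma partialB F G i j k : Ck_open k.+1 setT F -> Ck_open k.+1 setT G ->
  partial i j (fun x => F x - G x) = fun x => partial i j F x - partial i j G x.
Proof.
move=> CF CG; apply/funext => x.
by case: (is_deriveB (Ck_open_derive i j CF (I : setT x)) (Ck_open_derive i j CG I)).
Qed.

Lemma Ck_bound0 k M : Ck_bound k M 0 (fun=> 0).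
Proof.
elim: k => [|k IH]; first by split=> // x _; rewrite normr0.
split=> [x _|i j]; first by rewrite normr0.
rewrite (_ : partial i j _ = fun=> 0)//; apply/funext => x.
exact: derive_cst.
Qed.

Lemma Ck_boundD k M e e' F G : Ck_open k setT F -> Ck_open k setT G ->
  Ck_bound k M e F -> Ck_bound k M e' G -> Ck_bound k M (e + e') (fun x => F x + G x).
Proof.
elim: k F G => [|k IH] F G CF CG [bF dF] [bG dG]; (split; first by
  move=> x xM; rewrite (le_trans (ler_normD _ _))// lerD ?bF ?bG) => //.
move=> i j; rewrite (partialD _ _ CF CG).
by apply: IH (dF i j) (dG i j); [exact: Ck_open_partial CF|exact: Ck_open_partial CG].
Qed.

Lemma Ck_bound_sum k M e (I : Type) (r : seq I) (F : I -> 'M[R]_(n, d) -> R) :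
  (forall i, Ck_open k setT (F i)) -> (forall i, Ck_bound k M e (F i)) ->
  Ck_bound k M (\sum_(i <- r) e) (fun x => \sum_(i <- r) F i x).
Proof.
move=> CF bF; have oT := @openT 'M[R]_(n, d).
rewrite (_ : (fun x => _) = \sum_(i <- r) F i); last first.
  by apply/funext => x; rewrite fct_sumE.
elim: r => [|i r IH]; first by rewrite !big_nil; exact: Ck_bound0.
rewrite !big_cons; apply: Ck_boundD (CF i) _ (bF i) IH.
elim/big_rec : _ => [|l G _ CG]; first exact: Ck_open_cst.
exact: Ck_openD (CF l) CG.
Qed.

Lemma Ck_boundZ k M e c F : Ck_open k setT F ->
  Ck_bound k M e F -> Ck_bound k M (`|c| * e) (fun x => c * F x).
Proof.
elim: k F => [|k IH] F CF [bF dF]; (split; first by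
  move=> x xM; rewrite normrM ler_wpM2l ?bF) => //.
by move=> i j; rewrite (partialZ _ _ _ CF); apply: IH (dF i j); exact: Ck_open_partial CF.
Qed.

(** By Leibniz, $D^\alpha(x_{ab}F)$ is $x_{ab}D^\alpha F$ plus at most $k$ copies of a lower
    derivative of $F$, and $|x_{ab}|\le M$. *)
Lemma Ck_bound_coordM k M e (a : 'I_n) (b : 'I_d) F : 0 < M -> Ck_open k setT F ->
  Ck_bound k M e F -> Ck_bound k M ((k%:R + M) * e) (fun x => x a b * F x).
Proof.
(* A bound is nonnegative because the cube contains the origin. *)
move=> M0; have e0 k' e' F' : Ck_bound k' M e' F' -> 0 <= e'.
  move=> /Ck_bound_norm/(_ (fun i j => _ : - M <= (0 : 'M[R]_(n, d)) i j <= M)) bF.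
  by apply: le_trans (bF _) => // i j; rewrite mxE oppr_le0 ltW.
elim: k F => [|k IH] F CF bF; have e0' := e0 _ _ _ bF; have [b0 bd] := bF.
  split=> // x xM; rewrite normrM add0r ler_pM// ?b0//.
  by rewrite ler_norml; exact: xM.
split=> [x xM|i j].
  rewrite normrM ler_pM// ?b0//; apply: (@le_trans _ _ M); last by rewrite lerDr.
  by rewrite ler_norml; exact: xM.
have CX : Ck_open k.+1 setT (fun x : 'M[R]_(n, d) => x a b).
  by apply: Ck_open_coord; exact: openT.
rewrite (partialM _ _ CX CF).
have -> : (k.+1%:R + M) * e = (k%:R + M) * e + 1 * e by rewrite -natr1; ring.
have -> : partial i j (fun x : 'M[R]_(n, d) => x a b) = fun=> ((i == a) && (j == b))%:R.
  by apply/funext => x; case: (is_derive_coord a b i j x).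
have CF' := Ck_open_le (leqnSn k) CF.
apply: Ck_boundD.
- by apply: Ck_openM; [exact: openT|exact: Ck_open_le (leqnSn k) CX|exact: Ck_open_partial CF].
- under eq_fun do rewrite mulrC.
  by apply: Ck_openZ CF'; exact: openT.
- by apply: IH (bd i j); exact: Ck_open_partial CF.
- under eq_fun do rewrite mulrC.
  apply: (@Ck_bound_le _ _ (`|((i == a) && (j == b))%:R| * e)).
    by rewrite ler_wpM2r//; case: (_ && _); rewrite ?normr1// normr0 ler01.
  by apply: Ck_boundZ => //; exact: Ck_bound_pred.
Qed.

Lemma Ck_bound_row_perm (s : 'S_n) k M e F : Ck_open k setT F ->
  Ck_bound k M e F -> Ck_bound k M e (F \o row_perm s).
Proof.
elim: k F => [|k IH] F CF [bF dF]; (split; first by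
  move=> x xM; apply: bF => i j; rewrite mxE; exact: xM) => //.
move=> i j; rewrite (partial_slides _ _ (slides_row_perm s) CF) /=.
by apply: IH; [exact: Ck_open_partial CF|exact: dF].
Qed.

Lemma Ck_bound_iter i j m k M e F :
  Ck_bound (m + k) M e F -> Ck_bound k M e (iter m (partial i j) F).
Proof.
elim: m k => [//|m IH] k bF; have /= := IH k.+1.
by rewrite addnS => /(_ bF)[_]; apply.
Qed.

Lemma Ck_bound_Dmulti k M e F (a : 'M['I_k.+1]_(n, d)) x :
  (mindex_deg a <= k)%N -> Ck_bound k M e F -> cube M x -> `|Dmulti a F x| <= e.
Proof.
rewrite /mindex_deg pair_bigA /= /Dmulti => ak bF xM.
have {}ak : (\sum_(p <- enum {: 'I_n * 'I_d}) (a p.1 p.2 : nat) <= k)%N.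
  by rewrite big_enum.
suff H : Ck_bound (k - \sum_(p <- enum {: 'I_n * 'I_d}) (a p.1 p.2 : nat)) M e
    (foldr (fun ij => iter (a ij.1 ij.2) (partial ij.1 ij.2)) F
    (enum {: 'I_n * 'I_d})) by exact: Ck_bound_norm H xM.
elim: (enum _) ak => [|p s IH] /=; first by rewrite big_nil subn0.
rewrite big_cons => ak.
apply: Ck_bound_iter; rewrite addnC subnDA subnAC subnK.
  by apply: IH; apply: leq_trans ak; exact: leq_addl.
by rewrite leq_subRL ?(leq_trans _ ak) ?leq_addl // addnC.
Qed.

End Ck_bound.

(** * Convergence of the Bernstein operators *)

Section bernstein_convergence.
Context {R : realType} {n d : nat}.
Implicit Types (F G : 'M[R]_(n, d) -> R) (k : nat) (M e : R).

Lemma continuous_bounded_cube M G : 0 < M -> continuous G ->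
  exists2 C : R, 0 <= C & forall x, cube M x -> `|G x| <= C.
Proof.
move=> M0 cG; have c0 : cube M (0 : 'M[R]_(n, d)).
  by move=> i j; rewrite mxE oppr_le0 ltW.
have [||c _ cP] := @compact_EVT_max _ R (fun x => `|G x|) _ _ (@compact_cube R n d M).
- by exists 0.
- apply: continuous_subspaceT => x; apply: continuous_comp (cG x) _.
  exact: norm_continuous.
- by exists `|G c| => // x xM; apply: cP; rewrite inE.
Qed.

(* Uniform continuity, in the form suited to the variance estimate. *)
Lemma quadratic_modulus M G e : 0 < M -> 0 < e -> continuous G ->
  exists2 K : R, 0 <= K & forall (i : 'I_n) (j : 'I_d) x t, cube M x -> - M <= t <= M ->
    `|G (subst_coord i j t x) - G x| <= e + K * (t - x i j) ^+ 2.
Proof.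
move=> M0 e0 cG; have [C C0 CP] := continuous_bounded_cube M0 cG.
have [dl dl0 dlP] := compact_unif_near (@compact_cube R n d M) cG e0.
(* Where the coordinate moves by at least [dl], the quadratic term exceeds the trivial bound
   [2 * C]. *)
exists (2 * C / dl ^+ 2) => [|i j x t xM tM].
  by rewrite divr_ge0 ?sqr_ge0// mulr_ge0.
have K0 : 0 <= 2 * C / dl ^+ 2 by rewrite divr_ge0 ?sqr_ge0// mulr_ge0.
have [tdl|tdl] := ltP `|t - x i j| dl.
  apply: (@le_trans _ _ e); last by rewrite lerDl mulr_ge0 ?sqr_ge0.
  rewrite distrC; apply: dlP => // a b; rewrite subst_coordE; case: ifP.
    by move=> /andP[/eqP-> /eqP->]; rewrite distrC.
  by rewrite subrr normr0.
apply: (@le_trans _ _ (2 * C)).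
  rewrite (le_trans (ler_normB _ _))// mulr_natl mulr2n lerD ?CP//.
  by move=> a b; rewrite subst_coordE; case: ifP.
apply: (@le_trans _ _ (2 * C / dl ^+ 2 * (t - x i j) ^+ 2)); last by rewrite lerDr ltW.
rewrite -mulrA ler_peMr ?mulr_ge0// mulrC ler_pdivlMr ?exprn_gt0// mul1r.
by rewrite -[leRHS]real_normK ?num_real// ler_pXn2r ?nnegrE// ltW.
Qed.

(** Each coefficient is a value of the $r$-th derivative within $rh$ of its node, so
    [quadratic_modulus] bounds the error by a constant plus a multiple of the squared deviation,
    which [bern_sqr_dev] makes small. The factor [falling_ratio] tends to 1. *)
Lemma bern_op_uniform (i : 'I_n) (j : 'I_d) M r F e : 0 < M -> 0 < e ->
  Ck_open r setT F -> \forall N \near \oo, forall x, cube M x ->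
  `|iter r (partial i j) F x - falling_ratio N r *
     bern_op i j M (N - r) (2 * M / N%:R) (iter r (quotient_diff (2 * M / N%:R) i j) F) x|
  <= e.
Proof.
move=> M0 e0 CF; set g := iter r (partial i j) F.
have cg : continuous g.
  move=> x; apply: (@Ck_open_continuous _ _ _ 0 setT) => //.
  by apply: Ck_open_iter; rewrite addn0.
have [C C0 CP] := continuous_bounded_cube M0 cg.
have e4 : 0 < e / 4 by rewrite divr_gt0.
have [K K0 KP] := quadratic_modulus M0 e4 cg.
(* That is $2(2M)^2K$: the 2 from $(p+t)^2\le 2p^2+2t^2$, the square from rescaling $[0,1]$ to
   length $2M$. *)
pose K' := 8 * M ^+ 2 * K.
have K'0 : 0 <= K' by rewrite mulr_ge0// mulr_ge0// sqr_ge0.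
near=> N => x xM.
have N0 : (0 < N)%N by near: N; exact: nbhs_infty_gt.
have rN : (r <= N)%N by near: N; exact: nbhs_infty_ge.
(* Here $r^2+1$ comes from the squared deviation and another $r^2$ from the shift [t] of the
   evaluation points. *)
have HA : K' * (2 * r%:R ^+ 2 + 1) / N%:R <= e / 4.
  by near: N; exact: near_infty_div_le.
have HB : C * r%:R ^+ 2 / N%:R <= e / 4 by near: N; exact: near_infty_div_le.
set h := 2 * M / N%:R; set u := unit_coord i j M x.
have N0' : 0 < N%:R :> R by rewrite ltr0n.
have h0 : 0 < h by rewrite divr_gt0// mulr_gt0.
have u01 : 0 <= u <= 1 by exact: unit_coord_itv.
pose a m := iter r (quotient_diff h i j) F (subst_coord i j (m%:R * h - M) x).
(* Since $m+r\le N$, a shift by at most $rh$ from node $m$ does not pass $M$. *)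
have aP m : (m <= N - r)%N -> exists t, [/\ 0 <= t <= r%:R * h,
    - M <= m%:R * h - M + t <= M & a m = g (subst_coord i j (m%:R * h - M + t) x)].
  move=> mL; have [t t_itv E] := @quotient_diff_mean _ _ _ _ i j F r
    (subst_coord i j (m%:R * h - M) x) h0 CF.
  exists t; split=> //; last by rewrite subst_coord_add.
  have mr : (m%:R + r%:R) * h <= 2 * M.
    rewrite /h mulrA ler_pdivrMr// mulrC ler_pM2l ?mulr_gt0//.
    by rewrite -natrD ler_nat addnC -leq_subRL.
  have mh : 0 <= m%:R * h by rewrite mulr_ge0// ltW.
  by move: t_itv => /andP[t0 tr]; apply/andP; split; lra.
have xE : x i j = 2 * M * u - M.
  by rewrite /u /unit_coord mulrA divff ?mul1r ?addrK// gt_eqF// mulr_gt0.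
pose b m := K' * (m%:R / N%:R - u) ^+ 2 + (e / 4 + K' * (r%:R ^+ 2 / N%:R)).
have abP m : (m <= N - r)%N -> `|a m - g x| <= b m.
  move=> /aP[t [/andP[t0 tr] tM ->]]; apply: le_trans (KP i j x _ xM tM) _.
  rewrite /b addrCA lerD2l -mulrDr.
  pose p := 2 * M * (m%:R / N%:R - u).
  have -> : m%:R * h - M + t - x i j = p + t.
    by rewrite xE /p /h; field; rewrite gt_eqF.
  have pt : (p + t) ^+ 2 <= 2 * p ^+ 2 + 2 * t ^+ 2 by have := sqr_ge0 (p - t); nra.
  have t2 : t ^+ 2 <= (2 * M) ^+ 2 * (r%:R ^+ 2 / N%:R).
    apply: (@le_trans _ _ ((r%:R * h) ^+ 2)); first by rewrite ler_pXn2r ?nnegrE// (le_trans t0).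
    rewrite /h (_ : _ ^+ 2 = (2 * M) ^+ 2 * (r%:R ^+ 2 / N%:R) / N%:R); last first.
      by field; rewrite gt_eqF.
    rewrite ler_pdivrMr// ler_peMr ?ler1n//.
    by rewrite mulr_ge0 ?sqr_ge0 ?divr_ge0 ?sqr_ge0.
  apply: (@le_trans _ _ (K * (2 * p ^+ 2 + 2 * ((2 * M) ^+ 2 * (r%:R ^+ 2 / N%:R))))).
    by apply: ler_wpM2l => //; apply: (le_trans pt); rewrite lerD2l ler_pM2l.
  by rewrite /K' /p le_eqVlt; apply/orP; left; apply/eqP; ring.
have bB : bern (N - r) b u <= e / 4 + e / 4.
  rewrite /b bernD bernZ bern_cst.
  have := bern_sqr_dev N0 (subnK rN) u01; set w := bern _ _ _ => wle.
  have : K' * w <= K' * ((r%:R ^+ 2 + 1) / N%:R) by rewrite ler_wpM2l.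
  have : K' * (2 * r%:R ^+ 2 + 1) / N%:R =
    K' * ((r%:R ^+ 2 + 1) / N%:R) + K' * (r%:R ^+ 2 / N%:R) :> R by ring.
  by lra.
set B := bern_op _ _ _ _ _ _ _.
have BE : B = bern (N - r) a u by [].
have gB : `|g x - B| <= e / 4 + e / 4.
  apply: le_trans bB; rewrite distrC BE -[g x](bern_cst (N - r) _ u) -bernB.
  exact: bern_norm_le.
have BC : `|B| <= C.
  rewrite BE -[leRHS](bern_cst (N - r) _ u); apply: bern_norm_le => // m.
  move=> /aP[t [_ tM ->]]; apply: CP => c1 c2.
  by rewrite subst_coordE; case: ifP.
have /andP[k1 k2] := @falling_ratio_bounds R _ _ rN N0.
set q := falling_ratio N r in k1 k2 *.
have -> : g x - q * B = (g x - B) + (1 - q) * B by ring.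
apply: (le_trans (ler_normD _ _)); rewrite normrM.
have q1 : 0 <= 1 - q by rewrite subr_ge0.
rewrite (ger0_norm q1).
have : (1 - q) * `|B| <= r%:R ^+ 2 / N%:R * C.
  by apply: ler_pM => //; lra.
have -> : r%:R ^+ 2 / N%:R * C = C * r%:R ^+ 2 / N%:R by ring.
by lra.
Unshelve. all: by end_near. Qed.

(** Along $(i,j)$ the new factor $(N-r)/N$ completes [falling_ratio N r.+1] and the estimate is that
    of [r.+1]; along any other coordinate it is that of the same [r] for the partial derivative of
    [F]. *)
Lemma bern_op_Ck_bound (i : 'I_n) (j : 'I_d) M r k F e : 0 < M -> 0 < e ->
  Ck_open (r + k) setT F -> \forall N \near \oo, Ck_bound k M e (fun x =>
   iter r (partial i j) F x - falling_ratio N r *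
     bern_op i j M (N - r) (2 * M / N%:R) (iter r (quotient_diff (2 * M / N%:R) i j) F) x).
Proof.
move=> M0 e0; elim: k r F => [|k IH] r F CF.
  rewrite addn0 in CF; have := bern_op_uniform i j M0 e0 CF.
  by apply: filterS => N HN; split.
have CFr : Ck_open r setT F by apply: Ck_open_le CF; exact: leq_addr.
have CF1 : Ck_open (r + k).+1 setT F by rewrite -addnS.
have Cr1 : Ck_open r.+1 setT F by apply: Ck_open_le CF1; rewrite ltnS leq_addr.
have Cg : Ck_open 1 setT (iter r (partial i j) F) by apply: Ck_open_iter; rewrite addn1.
have Cq h : Ck_open 1 setT (iter r (quotient_diff h i j) F).
  elim: (r) => [|m IHm]; first by apply: Ck_open_le CF1.
  by rewrite iterS; exact: Ck_open_quotient_diff.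
pose D N a b := partial a b (fun x => iter r (partial i j) F x - falling_ratio N r *
     bern_op i j M (N - r) (2 * M / N%:R) (iter r (quotient_diff (2 * M / N%:R) i j) F) x).
have DE N a b : D N a b = fun x => partial a b (iter r (partial i j) F) x -
    falling_ratio N r * partial a b (bern_op i j M (N - r) (2 * M / N%:R)
      (iter r (quotient_diff (2 * M / N%:R) i j) F)) x.
  have CB := Ck_open_bern_op i j M (N - r) (2 * M / N%:R) (Cq (2 * M / N%:R)).
  rewrite /D (partialB _ _ Cg (Ck_openZ _ openT CB)).
  by rewrite (partialZ _ _ _ CB).
(* There are finitely many directions, so one threshold for [N] serves them all. *)
have H : \forall N \near \oo, forall p : 'I_n * 'I_d, Ck_bound k M e (D N p.1 p.2).
  apply: filter_forall => -[a b] /=.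
  have [[-> ->]|ab] := eqVneq (a, b) (i, j).
    have CF' : Ck_open (r.+1 + k) setT F by rewrite addSnnS.
    have := IH r.+1 F CF'; apply: filterS2; last exact: (nbhs_infty_gt r).
    move=> N rN; rewrite DE; congr Ck_bound; apply/funext => x; congr (_ - _).
    have N0 : N%:R != 0 :> R by rewrite pnatr_eq0 -lt0n (leq_ltn_trans _ rN).
    have h0 : 2 * M / N%:R != 0 by rewrite mulf_neq0 ?invr_eq0// mulf_neq0// gt_eqF.
    rewrite partial_bern_op// /falling_ratio big_ord_recr /= subnS.
    by field; rewrite N0 gt_eqF.
  have CF' : Ck_open (r + k) setT (partial a b F) by exact: Ck_open_partial CF1.
  have := IH r _ CF'; apply: filterS => N; rewrite DE.
  rewrite (partial_iterC _ _ _ _ Cr1) (partial_bern_op_neq _ _ _ ab (Cq _)).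
  by rewrite (iter_quotient_diffC _ _ _ _ _ _ CF1).
have H0 := bern_op_uniform i j M0 e0 CFr.
apply: filterS2 H H0 => N HN H0; split=> // a b; exact: (HN (a, b)).
Qed.

End bernstein_convergence.

(** * Polynomial approximation *)

Section polynomial_functions.
Context {R : realType} {n d : nat}.
Implicit Types (F G P : 'M[R]_(n, d) -> R) (k : nat) (M e : R).

(** Polynomials are handled as functions, closed under the operations used, and turned into [mpoly]
    objects once, in [polyf_poly_fun]. *)
Inductive polyf : ('M[R]_(n, d) -> R) -> Prop :=
| polyf_cst c : polyf (fun=> c)
| polyf_coord i j : polyf (fun x => x i j)
| polyfD P Q of polyf P & polyf Q : polyf (fun x => P x + Q x)
| polyfM P Q of polyf P & polyf Q : polyf (fun x => P x * Q x).

Lemma polyf_Ck k P : polyf P -> Ck_open k setT P.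
Proof.
have oT := @openT 'M[R]_(n, d).
elim=> [c|i j|{}P Q _ CP _ CQ|{}P Q _ CP _ CQ].
- exact: Ck_open_cst.
- exact: Ck_open_coord.
- exact: Ck_openD.
- exact: Ck_openM.
Qed.

Lemma polyf_row_perm (s : 'S_n) P : polyf P -> polyf (P \o row_perm s).
Proof.
elim=> [c|i j|{}P Q _ CP _ CQ|{}P Q _ CP _ CQ].
- exact: polyf_cst.
- rewrite (_ : _ \o _ = fun x : 'M[R]_(n, d) => x (s i) j); first exact: polyf_coord.
  by apply/funext => x; rewrite /= mxE.
- exact: polyfD CP CQ.
- exact: polyfM CP CQ.
Qed.

Lemma polyfZ c P : polyf P -> polyf (fun x => c * P x).
Proof. by move=> pP; apply: polyfM => //; exact: polyf_cst. Qed.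

Lemma polyf_sum (I : Type) (r : seq I) (P : I -> 'M[R]_(n, d) -> R) :
  (forall i, polyf (P i)) -> polyf (fun x => \sum_(i <- r) P i x).
Proof.
move=> pP; elim: r => [|i r IH].
  by under eq_fun do rewrite big_nil; exact: polyf_cst.
by under eq_fun do rewrite big_cons; exact: polyfD.
Qed.

Import -(notations) mpoly.

Lemma polyf_poly_fun P : polyf P -> exists p : mpoly.mpoly (n * d) R, poly_fun p = P.
Proof.
elim=> [c|i j|{}P Q _ [p <-] _ [q <-]|{}P Q _ [p <-] _ [q <-]].
- exists (mpoly.mpolyC (n * d) c); apply/funext => x.
  by rewrite /poly_fun mpoly.mevalC.
- exists (mpoly.mpolyX R (mpoly.mnm1 (mxvec_index i j))); apply/funext => x.
  by rewrite /poly_fun mpoly.mevalXU mxvecE.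
- exists (p + q); apply/funext => x.
  by rewrite /poly_fun mpoly.mevalD.
- exists (p * q); apply/funext => x.
  by rewrite /poly_fun mpoly.mevalM.
Qed.

(** The regularity clause is carried along because adding or scaling error bounds differentiates the
    errors term by term. *)
Definition approximable k M F :=
  Ck_open k setT F /\ forall e, 0 < e ->
  exists2 P, polyf P & Ck_bound k M e (fun x => F x - P x).

Lemma approximable_polyf k M P : polyf P -> approximable k M P.
Proof.
move=> pP; split=> [|e e0]; first exact: polyf_Ck.
exists P => //; under eq_fun do rewrite subrr.
exact: Ck_bound_le (ltW e0) (Ck_bound0 _ _).
Qed.

Lemma approximableD k M F G : approximable k M F -> approximable k M G ->
  approximable k M (fun x => F x + G x).
Proof.
have oT := @openT 'M[R]_(n, d).
move=> [CF aF] [CG aG]; split=> [|e e0]; first exact: Ck_openD.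
have e2 : 0 < e / 2 by rewrite divr_gt0.
have [P pP bP] := aF _ e2; have [Q pQ bQ] := aG _ e2.
exists (fun x => P x + Q x); first exact: polyfD.
rewrite [e]splitr; under eq_fun do rewrite opprD addrACA.
by apply: Ck_boundD => //; apply: Ck_openB => //; exact: polyf_Ck.
Qed.

Lemma approximableZ k M c F : approximable k M F -> approximable k M (fun x => c * F x).
Proof.
have oT := @openT 'M[R]_(n, d).
move=> [CF aF]; split=> [|e e0]; first exact: Ck_openZ.
have c0 : 0 < `|c| + 1 by rewrite ltr_wpDl.
have [|P pP bP] := aF (e / (`|c| + 1)); first by rewrite divr_gt0.
exists (fun x => c * P x); first exact: polyfZ.
under eq_fun do rewrite -mulrBr.
apply: (@Ck_bound_le _ _ _ _ _ (`|c| * (e / (`|c| + 1)))).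
  by rewrite mulrCA ler_piMr ?(ltW e0)// ler_pdivrMr// mul1r lerDl.
by apply: Ck_boundZ => //; apply: Ck_openB => //; exact: polyf_Ck.
Qed.

Lemma approximable_coordM k M (a : 'I_n) (b : 'I_d) F : 0 < M ->
  approximable k M F -> approximable k M (fun x => x a b * F x).
Proof.
have oT := @openT 'M[R]_(n, d).
move=> M0 [CF aF]; split=> [|e e0].
  by apply: Ck_openM => //; exact: Ck_open_coord.
have c0 : 0 < k%:R + M by rewrite ltr_wpDl.
have [|P pP bP] := aF (e / (k%:R + M)); first by rewrite divr_gt0.
exists (fun x : 'M[R]_(n, d) => x a b * P x); first by apply: polyfM => //; exact: polyf_coord.
under eq_fun do rewrite -mulrBr.
rewrite (_ : e = (k%:R + M) * (e / (k%:R + M))); last by rewrite mulrCA divff ?mulr1// gt_eqF.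
by apply: Ck_bound_coordM => //; apply: Ck_openB => //; exact: polyf_Ck.
Qed.

(** De Casteljau's recursion uses only sums, scalars and multiplication by the coordinate $x_{ij}$,
    so the coefficients may be arbitrary approximable functions. *)
Lemma approximable_bern k M (i : 'I_n) (j : 'I_d) N (a : nat -> 'M[R]_(n, d) -> R) :
  0 < M -> (forall m, approximable k M (a m)) ->
  approximable k M (fun x => bern N (a^~ x) (unit_coord i j M x)).
Proof.
move=> M0; elim: N a => [|N IH] a aa /=; first exact: aa.
have aU F : approximable k M F -> approximable k M (fun x => unit_coord i j M x * F x).
  move=> aF; rewrite (_ : (fun _ => _) = fun x : 'M[R]_(n, d) => (2 * M)^-1 * (x i j * F x + M * F x)).
    apply/approximableZ/approximableD; first exact: approximable_coordM.
    exact: approximableZ.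
  by apply/funext => x; rewrite /unit_coord; ring.
rewrite (_ : (fun _ => _) = fun x => (bern N (a^~ x) (unit_coord i j M x) +
    -1 * (unit_coord i j M x * bern N (a^~ x) (unit_coord i j M x))) +
    unit_coord i j M x * bern N (fun m => a m.+1 x) (unit_coord i j M x)); last first.
  by apply/funext => x; ring.
apply: approximableD; last by apply: aU; exact: (IH (fun m => a m.+1)).
apply: approximableD; first exact: IH.
by apply/approximableZ/aU; exact: IH.
Qed.

Lemma approximable_lim k M F : Ck_open k setT F ->
  (forall e, 0 < e -> exists2 G, approximable k M G & Ck_bound k M e (fun x => F x - G x)) ->
  approximable k M F.
Proof.
have oT := @openT 'M[R]_(n, d).
move=> CF lF; split=> // e e0.
have e2 : 0 < e / 2 by rewrite divr_gt0.
have [G [CG aG] bG] := lF _ e2; have [P pP bP] := aG _ e2.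
exists P => //; rewrite [e]splitr.
rewrite (_ : (fun _ => _) = fun x => (F x - G x) + (G x - P x)); last first.
  by apply/funext => x; ring.
by apply: Ck_boundD => //; apply: Ck_openB => //; exact: polyf_Ck.
Qed.

(* By induction on the coordinates F depends on: a Bernstein operator in one of
   them produces polynomials in it whose coefficients depend on the others. *)
Lemma Ck_approximable k M F : 0 < M -> Ck_open k setT F -> approximable k M F.
Proof.
move=> M0; suff H (s : seq ('I_n * 'I_d)) : forall G, Ck_open k setT G ->
    (forall x y : 'M[R]_(n, d), (forall p, p \in s -> x p.1 p.2 = y p.1 p.2) -> G x = G y) ->
    approximable k M G.
  move=> CF; apply: (H (enum {: 'I_n * 'I_d})) CF _ => x y xy; congr F.
  by apply/matrixP => i j; exact: (xy (i, j) (mem_enum _ _)).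
elim: s => [|[i j] s IH] G CG Gs.
  rewrite (_ : G = fun=> G 0); first exact/approximable_polyf/polyf_cst.
  by apply/funext => x; apply: Gs.
apply: approximable_lim => // e e0.
(* Only [r = 0] is applied, where [falling_ratio] is an empty product; the other values of [r] serve
   the induction on [k]. *)
have CG0 : Ck_open (0 + k) setT G by [].
have /filter_ex[N HN] := bern_op_Ck_bound i j M0 e0 CG0.
exists (bern_op i j M N (2 * M / N%:R) G).
  apply: approximable_bern => // m; apply: IH; first exact: Ck_open_subst_coord.
  move=> x y xy; apply: Gs => p; rewrite inE !subst_coordE.
  case: (p =P (i, j)) => [->|pij] /=; first by rewrite !eqxx.
  by move=> /xy ->.
move: HN; rewrite subn0 /falling_ratio big_ord0 /=.
by under eq_fun do rewrite mul1r.
Qed.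

End polynomial_functions.

(** * Symmetrization and conclusion *)

Lemma sum_row_perm (R : realType) (n d : nat) (F : 'M[R]_(n, d) -> R) (s : 'S_n) x :
  \sum_(t : 'S_n) F (row_perm t (row_perm s x)) = \sum_(t : 'S_n) F (row_perm t x).
Proof.
rewrite (reindex_inj (mulIg s^-1%g)) /=; apply: eq_bigr => t _; congr F.
by apply/matrixP => i j; rewrite !mxE permM permKV.
Qed.

Theorem corollary10 (R : realType) (n d k : nat) (hn : (2 <= n)%N)
    (hd : (1 <= d)%N) (Omega : set 'rV[R]_d) (hOmega : compact Omega)
    (f : 'M[R]_(n, d) -> R)
    (fsym : totally_symmetric_on (cart_pow n Omega) f)
    (fCk : Ck_on k (cart_pow n Omega) f) (eps : R) (heps : 0 < eps) :
  exists P : mpoly.mpoly (n * d) R,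
    totally_symmetric_on [set: 'M[R]_(n, d)] (poly_fun P) /\
    (Ck_norm k (cart_pow n Omega) (fun x => (f x - poly_fun P x)%R)
      < eps%:E)%E.
Proof.
have oT := @openT 'M[R]_(n, d).
have cV := @compact_cart_pow R n d Omega hOmega.
set V := cart_pow n Omega in fsym fCk cV *.
have [H CH Hf] := Ck_on_global cV fCk.
have [M M0 VM] := compact_sub_cube cV.
(* [Ck_sum] has fewer than [c] terms, so errors of [eps / 2 / c] add up to at most [eps / 2]; the
   halving yields the strict inequality. *)
pose c : R := #|{: 'M['I_k.+1]_(n, d)}|%:R + 1.
have c0 : 0 < c by rewrite ltr_wpDl.
have e0 : 0 < eps / 2 / c by rewrite !divr_gt0.
have [_ /(_ _ e0)[p pp bp]] := Ck_approximable M0 CH.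
pose w : R := #|{: 'S_n}|%:R^-1.
have w0 : #|{: 'S_n}|%:R != 0 :> R by rewrite pnatr_eq0 -lt0n; apply/card_gt0P; exists 1%g.
pose avg (F : 'M[R]_(n, d) -> R) x := w * \sum_(s : 'S_n) F (row_perm s x).
have pavg : polyf (avg p).
  by apply/polyfZ/polyf_sum => s; exact: (polyf_row_perm s pp).
have [P PE] := polyf_poly_fun pavg.
exists P; rewrite PE; split; first by move=> s x _; rewrite /avg sum_row_perm.
pose D x := H x - p x.
have CD : Ck_open k setT D by apply: Ck_openB => //; exact: polyf_Ck.
have CDs (s : 'S_n) : Ck_open k setT (D \o row_perm s).
  exact: Ck_open_slides (@row_perm_continuous _ _ _ s) (slides_row_perm s) CD.
have Csum (r : seq 'S_n) :
    Ck_open k setT (fun x => \sum_(s <- r) D (row_perm s x)).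
  exact: (@Ck_open_sum _ _ _ _ _ _ r xpredT (fun s => D \o row_perm s) oT (fun s _ => CDs s)).
have bavg : Ck_bound k M (eps / 2 / c) (avg D).
  have -> : eps / 2 / c = `|w| * \sum_(s : 'S_n) eps / 2 / c.
    rewrite ger0_norm ?invr_ge0// sumr_const -[X in _ = w * X]mulr_natl mulrA.
    by rewrite mulVf ?mul1r.
  apply: Ck_boundZ; first exact: Csum.
  apply: (@Ck_bound_sum _ _ _ _ _ _ _ _ (fun s => D \o row_perm s)) => // s.
  exact: Ck_bound_row_perm bp.
have ext : Ck_extension k V (fun x => f x - avg p x) (avg D).
  split.
    by exists setT; split=> //; apply: Ck_openZ.
  move=> x Vx; rewrite /avg /D sumrB mulrBr; congr (_ - _).
  (* On [V] each permuted value of [H] is a value of [f] at a permuted point of [V], hence [f x]. *)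
  rewrite (eq_bigr (fun=> f x)) => [|s _].
    by rewrite sumr_const -mulr_natl mulrA mulVf ?mul1r.
  rewrite Hf ?fsym// => i.
  by rewrite (_ : row i _ = row (s i) x)//; apply/rowP => j; rewrite !mxE.
apply: (@le_lt_trans _ _ (Ck_sum k V (avg D))%:E).
  by apply: ereal_inf_lbound; exists (avg D).
rewrite lte_fin; apply: (@le_lt_trans _ _ (eps / 2)); last by rewrite ltr_pdivrMr// ltr_pMr// ltr1n.
apply: (@le_trans _ _ (\sum_(a : 'M['I_k.+1]_(n, d)) eps / 2 / c)).
  (* The sum over multi-indices of degree at most [k] is enlarged to all index matrices, whose
     number defines [c]. *)
  rewrite /Ck_sum [leRHS](bigID (fun a : 'M['I_k.+1]_(n, d) => (mindex_deg a <= k)%N)) /=.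
  rewrite ler_wpDr//; first by apply: sumr_ge0 => a _; exact: ltW.
  apply: ler_sum => a ak.
  have [[x Vx]|V0] := pselect (V !=set0).
    apply: ge_sup; first by exists `|Dmulti a (avg D) x|; exists x.
    by move=> _ [y Vy <-]; apply: Ck_bound_Dmulti ak bavg _; exact: VM.
  (* For empty [V] the supremum is that of the empty set, which is 0 by convention. *)
  rewrite (_ : [set _ | _ in _] = set0) ?sup0 ?(ltW e0)//.
  by apply/seteqP; split=> [t [x Vx _]|t []]; case: V0; exists x.
rewrite sumr_const -[leLHS]mulr_natl mulrCA ler_piMr ?divr_ge0 ?(ltW heps)//.
by rewrite ler_pdivrMr// mul1r lerDl.
Qed.
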